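(* Let $m>0$ be an integer and let $G$ be a graph. The maps $l^*,r^*\colon\mathrm{N}_mG\to\mathrm{N}_{m+1}G$ are anodyne.
   Context: Graphs. A graph is a (possibly infinite) simple undirected graph without loops; write $v\sim w$ if $v,w$ are equal or joined by an edge. A graph map $f\colon G\to H$ is a function on vertices such that $v\sim w$ implies $f(v)\sim f(w)$. The product $G\otimes H$ has as vertices the pairs $(v,w)$, with $(v,w)\sim(v',w')$ iff ($v=v'$ and $w\sim w'$) or ($w=w'$ and $v\sim v'$); $G^{\otimes n}$ is the $n$-fold product, and $G^{\otimes 0}$ is the one-vertex graph. $I_m$ has vertices $0,\dots,m$ and edges between $i$ and $i+1$. Cubical sets. The box category $\square$ has objects the posets $[1]^n=\{0\le1\}^n$, $n\ge0$, with morphisms generated under composition (inside posets) by: faces $\partial_{i,\varepsilon}\colon[1]^{n-1}\to[1]^n$ ($1\le i\le n$) inserting $\varepsilon\in\{0,1\}$ in position $i$; degeneracies $\sigma_i\colon[1]^n\to[1]^{n-1}$ deleting the $i$-th coordinate; connections $\gamma_{i,0},\gamma_{i,1}\colon[1]^n\to[1]^{n-1}$ ($1\le i\le n-1$) replacing $x_i,x_{i+1}$ by their max and min respectively. A cubical set is a presheaf on $\square$. $\square^n$ is the representable presheaf of $[1]^n$; the open box $\sqcap^n_{i,\varepsilon}\subseteq\square^n$ ($n\ge1$, $1\le i\le n$, $\varepsilon\in\{0,1\}$) is the union of the images of all faces $\partial_{j,\eta}$, $(j,\eta)\ne(i,\varepsilon)$. A cubical map is anodyne if it lies in the smallest class of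 maps containing all open box inclusions $\sqcap^n_{i,\varepsilon}\hookrightarrow\square^n$ and closed under pushouts, retracts and transfinite composition. Nerves. For $m\ge1$, $\mathrm{N}_mG$ is the cubical set with $(\mathrm{N}_mG)_n$ the set of graph maps $I_m^{\otimes n}\to G$, with structure maps given by precomposition with: $\partial_{i,\varepsilon}\colon I_m^{\otimes n-1}\to I_m^{\otimes n}$ inserting $\varepsilon m$ in position $i$; $\sigma_i$ deleting the $i$-th coordinate; $\gamma_{i,0}$, $\gamma_{i,1}$ replacing $v_i,v_{i+1}$ by their max and min respectively. The graph maps $l,r\colon I_{m+1}\to I_m$ are $l(0)=0$, $l(v)=v-1$ for $v\ge1$; and $r(m+1)=m$, $r(v)=v$ for $v\le m$. The maps $l^*,r^*\colon\mathrm{N}_mG\to\mathrm{N}_{m+1}G$ are given on $n$-cubes by precomposition with $l^{\otimes n}$ and $r^{\otimes n}$ respectively. *)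

(* Defs.v *)
From mathcomp Require Import all_boot all_order.
From mathcomp Require Import boolp wochoice.

Set Implicit Arguments.
Unset Strict Implicit.
Unset Printing Implicit Defensive.

Import Order.TTheory.

Record graph : Type := Graph {
  vertex :> Type;
  edge : vertex -> vertex -> Prop;
  edge_irrefl : forall v, ~ edge v v;
  edge_sym : forall v w, edge v w -> edge w v }.

Definition sim (G : graph) (v w : G) : Prop := v = w \/ edge v w.

Record gmap (G H : graph) : Type := GMap {
  gfun :> G -> H;
  gmap_sim : forall v w, sim v w -> sim (gfun v) (gfun w) }.

Lemma gmap_eq (G H : graph) (f g : gmap G H) : f =1 g -> f = g.
Proof.
case: f g => f fP [g gP] /= /funext fg; case: _ / fg gP => gP.
by rewrite (Prop_irrelevance fP gP).
Qed.

Definition gcomp (G H K : graph) (g : gmap H K) (f : gmap G H) : gmap G K :=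
  GMap (fun v w vw => gmap_sim g (gmap_sim f vw)).

Section Product.
Variables G H : graph.

Definition gprod_edge (p q : G * H) : Prop :=
  (p.1 = q.1 /\ edge p.2 q.2) \/ (p.2 = q.2 /\ edge p.1 q.1).

Lemma gprod_edge_irrefl p : ~ gprod_edge p p.
Proof. by case=> -[_]; apply: edge_irrefl. Qed.

Lemma gprod_edge_sym p q : gprod_edge p q -> gprod_edge q p.
Proof. by case=> -[e /edge_sym]; [left | right]. Qed.

Definition gprod : graph := Graph gprod_edge_irrefl gprod_edge_sym.

Lemma sim_gprodE (p q : gprod) :
  sim p q <-> (p.1 = q.1 /\ sim p.2 q.2) \/ (p.2 = q.2 /\ sim p.1 q.1).
Proof.
case: p q => [v w] [v' w'] /=; split.
  by case=> [[-> ->]|[[/= -> e]|[/= -> e]]];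
    [left; split=> //; left | left; split=> //; right | right; split=> //; right].
by case=> -[-> [->|e]]; [left | right; left | left | right; right].
Qed.

End Product.

(* The n-fold product has the n-tuples of vertices, as functions on 'I_n, as
   its vertices; two of them are joined when they differ at exactly one
   coordinate, by an edge. [gpow0] and [gpowS] identify it with the iterated
   binary product. *)
Section Power.
Variables (G : graph) (n : nat).

Definition gpow_edge (x y : 'I_n -> G) : Prop :=
  exists i, edge (x i) (y i) /\ forall j, j != i -> x j = y j.

Lemma gpow_edge_irrefl x : ~ gpow_edge x x.
Proof. by case=> i [/edge_irrefl]. Qed.

Lemma gpow_edge_sym x y : gpow_edge x y -> gpow_edge y x.
Proof. by case=> i [/edge_sym e xy]; exists i; split=> // j /xy. Qed.

Definition gpow : graph := Graph gpow_edge_irrefl gpow_edge_sym.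

Lemma sim_gpow (x y : gpow) (i : 'I_n) :
  sim (x i) (y i) -> (forall j, j != i -> x j = y j) -> sim x y.
Proof.
case=> [e|e] xy; last by right; exists i.
by left; apply/funext => j; have [->//|/xy] := eqVneq j i.
Qed.

End Power.

Lemma gpow0 (G : graph) : exists! x : gpow G 0, True.
Proof.
exists (fun i : 'I_0 => match ltac:(by case: i) : False with end).
by split=> // x _; apply/funext; case.
Qed.

Lemma gpowS (G : graph) (n : nat) :
  let phi (x : gpow G n.+1) : gprod G (gpow G n) :=
    (x ord0, fun i => x (lift ord0 i)) in
  bijective phi /\ forall x y, edge x y <-> edge (phi x) (phi y).
Proof.
move=> phi; split.
  exists (fun p i => if unlift ord0 i is Some k then p.2 k else p.1).
    by move=> x; apply/funext => i; case: unliftP => [k|] ->.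
  case=> v w; rewrite /phi /= unlift_none; congr pair.
  by apply/funext => i; rewrite liftK.
move=> x y; split.
  case=> i; case: (unliftP ord0 i) => [k ->|->] [e xy].
    left; split; first exact: xy.
    by exists k; split=> // j jk; apply: xy; rewrite (inj_eq lift_inj).
  by right; split=> //; apply/funext => j; apply: xy; rewrite eq_sym neq_lift.
case=> [[/= e0 [k [e xy]]]|[/= e0 e]].
  exists (lift ord0 k); split=> // j; case: (unliftP ord0 j) => [j' ->|->] //.
  by rewrite (inj_eq lift_inj) => /xy.
exists ord0; split=> // j; case: (unliftP ord0 j) => [j' ->|->]; last by rewrite eqxx.
by move=> _; apply: (congr1 (fun f => f j') e0).
Qed.

Section PowerMap.
Variables (G H : graph) (h : gmap G H) (n : nat).

Lemma gpow_map_sim (x y : gpow G n) :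
  sim x y -> sim ((h \o x : gpow H n)) (h \o y).
Proof.
case=> [->|[i [e xy]]]; first by left.
apply: (@sim_gpow _ _ _ _ i) => [|j /xy /= ->] //.
by apply: gmap_sim; right.
Qed.

Definition gpow_map : gmap (gpow G n) (gpow H n) := GMap gpow_map_sim.

End PowerMap.

Section Interval.
Variable m : nat.

Definition interval_edge (u v : 'I_m.+1) : Prop := (u.+1 == v) || (v.+1 == u).

Lemma interval_edge_irrefl v : ~ interval_edge v v.
Proof. by rewrite /interval_edge orbb gtn_eqF. Qed.

Lemma interval_edge_sym u v : interval_edge u v -> interval_edge v u.
Proof. by rewrite /interval_edge orbC. Qed.

Definition interval : graph := Graph interval_edge_irrefl interval_edge_sym.

Lemma sim_intervalE (u v : interval) :
  sim u v <-> (u <= (v : 'I_m.+1).+1) && (v <= (u : 'I_m.+1).+1).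
Proof.
rewrite /sim /= /interval_edge; split.
  case=> [->|/orP[] /eqP <-]; first by rewrite leqnSn.
    by rewrite leqnn andbT; do 2!apply: leqW.
  by rewrite leqnn /=; do 2!apply: leqW.
case/andP; rewrite leq_eqVlt => /orP[/eqP -> _|]; first by right; rewrite eqxx orbT.
rewrite ltnS => uv; rewrite leq_eqVlt => /orP[/eqP ->|]; first by right; rewrite eqxx.
by rewrite ltnS => vu; left; apply/val_inj/eqP; rewrite eqn_leq uv.
Qed.

End Interval.

Definition cube (T : Type) (n : nat) : Type := 'I_n -> T.

(* Indices are counted from 0. With T := bool these are the generators of the
   box category; with T := 'I_m.+1 they are the structure maps between the
   powers of the interval graph (there \top is m). In [conn], e = false gives
   max and e = true gives min. *)
Section Generators.
Context {d : Order.disp_t} {T : tbPreorderType d}.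

Definition face n (i : 'I_n.+1) (e : bool) (x : cube T n) : cube T n.+1 :=
  fun j => if unlift i j is Some k then x k
           else if e then \top%O else \bot%O.

Definition degen n (i : 'I_n.+1) (x : cube T n.+1) : cube T n :=
  fun j => x (lift i j).

Definition conn n (i : 'I_n.+1) (e : bool) (x : cube T n.+2) : cube T n.+1 :=
  let i1 : 'I_n.+2 := lift ord0 i in
  fun j => if j == i
           then if e then Order.min (x (lift i1 i)) (x i1)
                else Order.max (x (lift i1 i)) (x i1)
           else x (lift i1 j).

End Generators.

(* Hence [lift i1 i] and [i1] in [conn] are the coordinates i and i + 1. *)
Lemma lift_conn n (i j : 'I_n.+1) :
  lift (lift ord0 i : 'I_n.+2) j = (if j <= i then j : nat else j.+1) :> nat.
Proof. by rewrite /= /bump /= add1n; case: leqP; rewrite ?add0n ?add1n. Qed.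

Inductive box_mor :
  forall p q, (cube bool p -> cube bool q) -> Prop :=
| BoxId n : @box_mor n n id
| BoxFace n (i : 'I_n.+1) e : box_mor (face i e)
| BoxDegen n (i : 'I_n.+1) : box_mor (@degen _ bool n i)
| BoxConn n (i : 'I_n.+1) e : box_mor (@conn _ bool n i e)
| BoxComp p q r (g : cube bool q -> cube bool r)
    (f : cube bool p -> cube bool q) :
    box_mor g -> box_mor f -> box_mor (g \o f).

Record box (p q : nat) : Type := Box {
  bfun :> cube bool p -> cube bool q;
  boxP : box_mor bfun }.

Definition box_id n : box n n := Box (BoxId n).

Definition box_comp p q r (g : box q r) (f : box p q) : box p r :=
  Box (BoxComp (boxP g) (boxP f)).

Definition box_face n (i : 'I_n.+1) (e : bool) : box n n.+1 :=
  Box (BoxFace i e).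

Lemma box_eq p q (f g : box p q) : f =1 g -> f = g.
Proof.
case: f g => f fP [g gP] /= /funext fg; case: _ / fg gP => gP.
by rewrite (Prop_irrelevance fP gP).
Qed.

Record cset : Type := CSet {
  cell :> nat -> Type;
  act : forall p q, box p q -> cell q -> cell p;
  act_id : forall n (x : cell n), act (box_id n) x = x;
  act_comp : forall p q r (g : box q r) (f : box p q) (x : cell r),
    act (box_comp g f) x = act f (act g x) }.

Record cmap (X Y : cset) : Type := CMap {
  capp :> forall n, X n -> Y n;
  cmap_nat : forall p q (f : box p q) (x : X q),
    capp (act f x) = act f (capp x) }.

Lemma cmap_eq (X Y : cset) (f g : cmap X Y) :
  (forall n (x : X n), f n x = g n x) -> f = g.
Proof.
case: f g => f fP [g gP] /= fg.
have {}fg : f = g by apply: functional_extensionality_dep => n; exact/funext.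
by case: _ / fg gP => gP; rewrite (Prop_irrelevance fP gP).
Qed.

Definition cmap_id (X : cset) : cmap X X :=
  @CMap X X (fun n x => x) (fun p q f x => erefl).

Lemma cmap_comp_nat (X Y Z : cset) (g : cmap Y Z) (f : cmap X Y)
  p q (h : box p q) (x : X q) : g p (f p (act h x)) = act h (g q (f q x)).
Proof. by rewrite !cmap_nat. Qed.

Definition cmap_comp (X Y Z : cset) (g : cmap Y Z) (f : cmap X Y) : cmap X Z :=
  CMap (cmap_comp_nat g f).

Lemma repr_act_id n p (x : box p n) : box_comp x (box_id p) = x.
Proof. exact: box_eq. Qed.

Lemma repr_act_comp n p q r (g : box q r) (f : box p q) (x : box r n) :
  box_comp x (box_comp g f) = box_comp (box_comp x g) f.
Proof. exact: box_eq. Qed.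

Definition repr (n : nat) : cset :=
  @CSet (fun k => box k n) (fun p q f x => box_comp x f)
    (@repr_act_id n) (@repr_act_comp n).

Section OpenBox.
Variables (n : nat) (i : 'I_n.+1) (e : bool).

Definition in_open_box k (x : repr n.+1 k) : Prop :=
  exists (j : 'I_n.+1) (h : bool),
    (j, h) <> (i, e) /\ exists y : repr n k, x = box_comp (box_face j h) y.

Lemma in_open_box_act p q (f : box p q) (x : repr n.+1 q) :
  in_open_box x -> in_open_box (act f x).
Proof.
case=> j [h [jh [y ->]]]; exists j, h; split=> //.
by exists (box_comp y f); apply: box_eq.
Qed.

Definition open_box_act p q (f : box p q)
    (x : {x : repr n.+1 q | in_open_box x}) :
    {x : repr n.+1 p | in_open_box x} :=
  exist _ (act f (sval x)) (in_open_box_act f (svalP x)).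

Lemma open_box_act_id k (x : {x : repr n.+1 k | in_open_box x}) :
  open_box_act (box_id k) x = x.
Proof. by case: x => x xP; apply: eq_exist; exact: (repr_act_id x). Qed.

Lemma open_box_act_comp p q r (g : box q r) (f : box p q)
    (x : {x : repr n.+1 r | in_open_box x}) :
  open_box_act (box_comp g f) x = open_box_act f (open_box_act g x).
Proof. by case: x => x xP; apply: eq_exist; exact: (repr_act_comp g f x). Qed.

Definition open_box : cset := CSet open_box_act_id open_box_act_comp.

Definition open_box_incl : cmap open_box (repr n.+1) :=
  @CMap open_box (repr n.+1) (fun k x => sval x) (fun p q f x => erefl).

End OpenBox.

Definition is_pushout (A B C D : cset) (f : cmap A B) (g : cmap A C)
    (g' : cmap B D) (f' : cmap C D) : Prop :=
  cmap_comp g' f = cmap_comp f' g /\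
  forall (Z : cset) (u : cmap B Z) (v : cmap C Z),
    cmap_comp u f = cmap_comp v g ->
    exists! w : cmap D Z, cmap_comp w g' = u /\ cmap_comp w f' = v.

Definition is_retract (A B C D : cset) (f : cmap A B) (g : cmap C D) : Prop :=
  exists (i : cmap A C) (r : cmap C A) (j : cmap B D) (s : cmap D B),
    [/\ cmap_comp r i = cmap_id A, cmap_comp s j = cmap_id B,
        cmap_comp g i = cmap_comp j f & cmap_comp f r = cmap_comp s g].

Section Sequences.
Variables (I : Type) (le : rel I).

Definition olt (i j : I) : Prop := le i j /\ i <> j.

Definition is_succ (i j : I) : Prop :=
  olt i j /\ forall k, ~ (olt i k /\ olt k j).

Definition is_limit (j : I) : Prop :=
  (exists i, olt i j) /\ forall i, ~ is_succ i j.

Record seq_diagram : Type := SeqDiagram {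
  stage :> I -> cset;
  trans : forall i j, le i j -> cmap (stage i) (stage j);
  trans_id : forall i (ii : le i i), trans ii = cmap_id (stage i);
  trans_comp : forall i j k (ij : le i j) (jk : le j k) (ik : le i k),
    cmap_comp (trans jk) (trans ij) = trans ik }.

(* [is_cocone] and [is_colimit] refer to the restriction of X to D. *)
Definition is_cocone (X : seq_diagram) (D : I -> Prop) (L : cset)
    (c : forall i, D i -> cmap (X i) L) : Prop :=
  forall i j (Di : D i) (Dj : D j) (ij : le i j),
    cmap_comp (c j Dj) (trans X ij) = c i Di.

Definition is_colimit (X : seq_diagram) (D : I -> Prop) (L : cset)
    (c : forall i, D i -> cmap (X i) L) : Prop :=
  is_cocone c /\
  forall (Z : cset) (d : forall i, D i -> cmap (X i) Z), is_cocone d ->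
    exists! u : cmap L Z, forall i (Di : D i), cmap_comp u (c i Di) = d i Di.

Definition is_continuous (X : seq_diagram) : Prop :=
  forall j, is_limit j ->
    @is_colimit X (fun i => olt i j) (X j)
      (fun i (ij : olt i j) => trans X (proj1 ij)).

End Sequences.

Definition cmap_class : Type := forall X Y : cset, cmap X Y -> Prop.

Definition has_open_boxes (W : cmap_class) : Prop :=
  forall n (i : 'I_n.+1) (e : bool), W _ _ (open_box_incl i e).

Definition pushout_closed (W : cmap_class) : Prop :=
  forall (A B C D : cset) (f : cmap A B) (g : cmap A C)
    (g' : cmap B D) (f' : cmap C D),
    is_pushout f g g' f' -> W A B f -> W C D f'.

Definition retract_closed (W : cmap_class) : Prop :=
  forall (A B C D : cset) (f : cmap A B) (g : cmap C D),
    is_retract f g -> W C D g -> W A B f.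

(* Ordinals are represented by arbitrary well-ordered types; [bot] is 0. *)
Definition transfinite_closed (W : cmap_class) : Prop :=
  forall (I : Type) (le : rel I) (bot : I) (X : seq_diagram le)
    (L : cset) (c : forall i, True -> cmap (X i) L),
    well_order le -> (forall i, le bot i) ->
    is_continuous X ->
    (forall i j (ij : le i j), is_succ le i j -> W (X i) (X j) (trans X ij)) ->
    is_colimit c ->
    W (X bot) L (c bot Logic.I).

Definition anodyne (X Y : cset) (f : cmap X Y) : Prop :=
  forall W : cmap_class,
    has_open_boxes W -> pushout_closed W -> retract_closed W ->
    transfinite_closed W -> W X Y f.

(* A morphism f of the box category acts on the powers of {0 <= ... <= m}
   level by level: applying f to the m binary threshold vectors
   (t < v_i)_i, t < m, of v and adding up the results. By [ext_id],
   [ext_comp], [ext_face], [ext_degen] and [ext_conn] this is the (unique)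
   functorial extension of the prescribed action of the generators. *)
Definition thr m p (t : nat) (v : cube 'I_m.+1 p) : cube bool p :=
  fun i => t < v i.

Definition ext m p q (f : cube bool p -> cube bool q) (v : cube 'I_m.+1 p) :
    cube 'I_m.+1 q :=
  fun j => inord (\sum_(t < m) f (thr t v) j).

Lemma sum_antitone (P : nat -> bool) m t :
  (forall s r, s <= r -> P r -> P s) ->
  (t < \sum_(s < m) P s) = (t < m) && P t.
Proof.
move=> anti; elim: m t => [|m IH] t; first by rewrite big_ord0.
rewrite big_ord_recr /=; case: (boolP (P m)) => Pm /=; last first.
  rewrite addn0 IH ltnS (leq_eqVlt t); case: eqP => //= ->.
  by rewrite ltnn (negbTE Pm).
have -> : \sum_(s < m) P s = m.
  rewrite (eq_bigr (fun=> 1)) ?sum1_card ?card_ord // => s _.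
  by rewrite (anti s m) // ltnW.
by rewrite addn1; case: ltnP => //= tm; rewrite (anti t m).
Qed.

Lemma sum_thr m k : k <= m -> \sum_(t < m) (t < k)%N = k.
Proof.
move=> km; have h t := @sum_antitone (fun t => t < k) m t (fun s r => @leq_ltn_trans r s k).
apply/eqP; rewrite eqn_leq; apply/andP; split.
  by rewrite leqNgt h ltnn andbF.
by case: k km h => // k km h; rewrite h km ltnSn.
Qed.

Lemma val_max m (a b : 'I_m.+1) : Order.max a b = maxn a b :> nat.
Proof. by rewrite maxElt ltEord /maxn; case: ifP. Qed.

Lemma val_min m (a b : 'I_m.+1) : Order.min a b = minn a b :> nat.
Proof. by rewrite minElt ltEord /minn; case: ifP. Qed.

Lemma ext_val m p q (f : cube bool p -> cube bool q) (v : cube 'I_m.+1 p) j :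
  ext f v j = \sum_(t < m) f (thr t v) j :> nat.
Proof.
rewrite inordK // ltnS -[leqRHS]card_ord -sum1_card leq_sum // => t _.
exact: leq_b1.
Qed.

Lemma ext_id m n : @ext m n n id =1 id.
Proof.
move=> v; apply/funext => j; apply: val_inj; rewrite /= ext_val.
by rewrite sum_thr // -ltnS.
Qed.

Lemma ext_face m n (i : 'I_n.+1) e : @ext m _ _ (face i e) =1 face i e.
Proof.
move=> v; apply/funext => j; apply: val_inj; rewrite /= ext_val /face.
case: (unliftP i j) => [k _|_]; first by rewrite sum_thr // -ltnS.
by case: e; rewrite sum_nat_const card_ord ?muln1 ?muln0.
Qed.

Lemma ext_degen m n (i : 'I_n.+1) :
  @ext m _ _ (@degen _ bool n i) =1 @degen _ 'I_m.+1 n i.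
Proof.
move=> v; apply/funext => j; apply: val_inj; rewrite /= ext_val /degen.
by rewrite sum_thr // -ltnS.
Qed.

Lemma ext_conn m n (i : 'I_n.+1) e : @ext m _ _ (conn i e) =1 conn i e.
Proof.
move=> v; apply/funext => j; apply: val_inj; rewrite /= ext_val /conn /thr.
case: eqP => _; last by rewrite sum_thr // -ltnS.
set a := v _; set b := v _.
case: e; rewrite ?val_max ?val_min.
  rewrite (eq_bigr (fun t : 'I_m => (t < minn a b) : nat)) => [|t _].
    by rewrite sum_thr // geq_min -ltnS ltn_ord.
  by rewrite leq_min; case: (t < a); case: (t < b).
rewrite (eq_bigr (fun t : 'I_m => (t < maxn a b) : nat)) => [|t _].
  by rewrite sum_thr // geq_max !leq_ord.
by rewrite leq_max; case: (t < a); case: (t < b).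
Qed.

Definition monotone p q (f : cube bool p -> cube bool q) : Prop :=
  forall x y : cube bool p, (forall i, x i -> y i) -> forall j, f x j -> f y j.

Lemma box_mor_monotone p q (f : cube bool p -> cube bool q) :
  box_mor f -> monotone f.
Proof.
elim=> {p q f} [n|n i e|n i|n i e|p q r g f _ gm _ fm] x y xy j.
- exact: xy.
- by rewrite /face; case: unliftP => //= k _; exact: xy.
- exact: xy.
- rewrite /conn; case: eqP => _; last exact: xy.
  set i1 : 'I_n.+2 := lift ord0 i.
  move: (xy (lift i1 i)) (xy i1); case: e;
    case: (x (lift i1 i)) (y (lift i1 i)) (x i1) (y i1) => [] [] [] [] // h1 h2;
    by [exact: h1 | exact: h2].
- exact/gm/fm.
Qed.

Lemma thr_ext m p q (f : cube bool p -> cube bool q) (v : cube 'I_m.+1 p) t :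
  monotone f -> t < m -> thr t (ext f v) = f (thr t v).
Proof.
move=> fm tm; apply/funext => j; rewrite /thr ext_val.
rewrite (@sum_antitone (fun t => f (thr t v) j)) ?tm // => s r sr.
by apply: fm => i; apply: leq_ltn_trans.
Qed.

Lemma ext_comp m p q r (g : cube bool q -> cube bool r)
    (f : cube bool p -> cube bool q) :
  monotone f -> @ext m _ _ (g \o f) =1 ext g \o ext f.
Proof.
move=> fm v; apply/funext => j; apply: val_inj; rewrite /= !ext_val.
by apply: eq_bigr => t _; rewrite thr_ext.
Qed.

Lemma sim_face m n (i : 'I_n.+1) e (v w : gpow (interval m) n) :
  sim v w -> sim (face i e v : gpow (interval m) n.+1) (face i e w).
Proof.
case=> [->|[k [vw eq_vw]]]; first by left.
apply: (@sim_gpow _ _ _ _ (lift i k)); rewrite /face.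
  by rewrite liftK; right.
by move=> j; case: (unliftP i j) => [l ->|//]; rewrite (inj_eq lift_inj) => /eq_vw.
Qed.

Lemma sim_degen m n (i : 'I_n.+1) (v w : gpow (interval m) n.+1) :
  sim v w -> sim (degen i v : gpow (interval m) n) (degen i w).
Proof.
case=> [->|[k [vw eq_vw]]]; first by left.
case: (unliftP i k) vw eq_vw => [l ->|->] vw eq_vw.
  apply: (@sim_gpow _ _ _ _ l); rewrite /degen; first by right.
  by move=> j jl; apply: eq_vw; rewrite (inj_eq lift_inj).
by left; apply/funext => j; apply: eq_vw; rewrite eq_sym neq_lift.
Qed.

Lemma sim_conn m n (i : 'I_n.+1) e (v w : gpow (interval m) n.+2) :
  sim v w -> sim (conn i e v : gpow (interval m) n.+1) (conn i e w).
Proof.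
case=> [->|[k [vw eq_vw]]]; first by left.
set i1 : 'I_n.+2 := lift ord0 i.
pose op (a b : 'I_m.+1) : 'I_m.+1 := if e then Order.min a b else Order.max a b.
have sim_op (a b a' b' : interval m) :
    sim a a' -> sim b b' -> sim (op a b : interval m) (op a' b').
  move=> /sim_intervalE/andP[h1 h2] /sim_intervalE/andP[h3 h4].
  apply/sim_intervalE; rewrite /op; case: (e); rewrite ?val_max ?val_min.
    by rewrite -!minnSS !leq_min !geq_min h1 h2 h3 h4 !orbT.
  by rewrite -!maxnSS !geq_max !leq_max h1 h2 h3 h4 !orbT.
have sim_vw j : sim (v j) (w j).
  by have [->|/eq_vw ->] := eqVneq j k; [right | left].
pose j0 := odflt i (unlift i1 k).
apply: (@sim_gpow _ _ _ _ j0); rewrite /conn -/i1.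
  by case: eqP => // _; apply: sim_op.
move=> j; rewrite /j0; case: (unliftP i1 k) eq_vw => [l ->|->] eq_vw /= jl.
  case: eqP => [ji|_]; last by rewrite eq_vw // (inj_eq lift_inj).
  by rewrite !eq_vw ?neq_lift // (inj_eq lift_inj) -ji.
by rewrite (negbTE jl) eq_vw // eq_sym neq_lift.
Qed.

Lemma ext_sim m p q (f : box p q) (v w : gpow (interval m) p) :
  sim v w -> sim (ext f v : gpow (interval m) q) (ext f w).
Proof.
case: f => /= f fP; elim: fP v w => {p q f}
  [n|n i e|n i|n i e|p q r g f gP IHg fP IHf] v w vw.
- by rewrite !ext_id.
- by rewrite !ext_face; apply: sim_face.
- by rewrite !ext_degen; apply: sim_degen.
- by rewrite !ext_conn; apply: sim_conn.
- by rewrite !ext_comp; [apply/IHg/IHf | apply: box_mor_monotone..].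
Qed.

Definition ext_gmap m p q (f : box p q) :
    gmap (gpow (interval m) p) (gpow (interval m) q) :=
  GMap (@ext_sim m p q f).

Section Nerve.
Variables (m : nat) (G : graph).

Definition nerve_act p q (f : box p q) (x : gmap (gpow (interval m) q) G) :
    gmap (gpow (interval m) p) G :=
  gcomp x (ext_gmap m f).

Lemma nerve_act_id n (x : gmap (gpow (interval m) n) G) :
  nerve_act (box_id n) x = x.
Proof. by apply: gmap_eq => v; rewrite /= ext_id. Qed.

Lemma nerve_act_comp p q r (g : box q r) (f : box p q)
    (x : gmap (gpow (interval m) r) G) :
  nerve_act (box_comp g f) x = nerve_act f (nerve_act g x).
Proof.
by apply: gmap_eq => v; rewrite /= ext_comp //; apply/box_mor_monotone/boxP.
Qed.

Definition nerve : cset := CSet nerve_act_id nerve_act_comp.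

End Nerve.

Section Precomposition.
Variables (m : nat) (h : gmap (interval m.+1) (interval m)).

Definition chain_mor : Prop :=
  [/\ h ord0 = ord0 :> 'I_m.+1, h ord_max = ord_max :> 'I_m.+1
    & forall u v : 'I_m.+2, u <= v -> (h u : 'I_m.+1) <= (h v : 'I_m.+1)].

Lemma chain_mor_ext p q (f : box p q) : chain_mor ->
  gcomp (gpow_map h q) (ext_gmap m.+1 f) = gcomp (ext_gmap m f) (gpow_map h p).
Proof.
case=> h0 h1 hle; apply: gmap_eq => v /=.
case: f => /= f fP; elim: fP v => {p q f}
  [n|n i e|n i|n i e|p q r g f gP IHg fP IHf] v.
- by rewrite !ext_id.
- rewrite !ext_face; apply/funext => j /=; rewrite /face.
  by case: (unliftP i j) => //= _; case: e.
- by rewrite !ext_degen.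
- rewrite !ext_conn; apply/funext => j /=; rewrite /conn.
  case: eqP => // _; set a := v _; set b := v _; apply: val_inj => /=.
  have [ab|/ltnW ba] := leqP (a : 'I_m.+2) (b : 'I_m.+2).
    case: e; rewrite ?val_max ?val_min.
      by rewrite (minn_idPl (hle _ _ ab)) min_l.
    by rewrite (maxn_idPr (hle _ _ ab)) max_r.
  case: e; rewrite ?val_max ?val_min.
    by rewrite (minn_idPr (hle _ _ ba)) min_r.
  by rewrite (maxn_idPl (hle _ _ ba)) max_l.
- rewrite !ext_comp; try exact: box_mor_monotone.
  by rewrite /= IHg IHf.
Qed.

Variable G : graph.

Lemma nerve_precomp_nat : chain_mor ->
  forall p q (f : box p q) (x : nerve m G q),
  gcomp (act f x) (gpow_map h p) =
  act f (gcomp x (gpow_map h q) : nerve m.+1 G q).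
Proof.
move=> hP p q f x; apply: gmap_eq => v /=.
by have /(congr1 (fun k => gfun k v)) /= -> := chain_mor_ext f hP.
Qed.

Definition nerve_precomp (hP : chain_mor) : cmap (nerve m G) (nerve m.+1 G) :=
  @CMap (nerve m G) (nerve m.+1 G) (fun n x => gcomp x (gpow_map h n))
    (nerve_precomp_nat hP).

End Precomposition.

Section LeftRight.
Variable m : nat.

Definition lfun (v : interval m.+1) : interval m := inord (v : 'I_m.+2).-1.

Definition rfun (v : interval m.+1) : interval m :=
  inord (minn (v : 'I_m.+2) m).

Lemma lfunE (v : interval m.+1) : (lfun v : 'I_m.+1) = (v : 'I_m.+2).-1 :> nat.
Proof. by rewrite inordK //; case: v => -[|v]. Qed.

Lemma rfunE (v : interval m.+1) :
  (rfun v : 'I_m.+1) = minn (v : 'I_m.+2) m :> nat.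
Proof. by rewrite inordK // ltnS geq_minr. Qed.

Lemma lfun_sim v w : sim v w -> sim (lfun v) (lfun w).
Proof.
move=> /sim_intervalE/andP[h1 h2]; apply/sim_intervalE; rewrite !lfunE.
have pred_le a b : a <= b.+1 -> a.-1 <= b.-1.+1.
  by case: a b => [|a] [|b] //; rewrite ltnS leqn0 => /eqP ->.
by rewrite !pred_le.
Qed.

Lemma rfun_sim v w : sim v w -> sim (rfun v) (rfun w).
Proof.
move=> /sim_intervalE/andP[h1 h2]; apply/sim_intervalE; rewrite !rfunE.
by rewrite -!minnSS !leq_min !geq_min h1 h2 leqnSn !orbT.
Qed.

Definition lmap : gmap (interval m.+1) (interval m) := GMap lfun_sim.
Definition rmap : gmap (interval m.+1) (interval m) := GMap rfun_sim.

Lemma lmap_chain : chain_mor lmap.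
Proof.
split; [apply: val_inj; rewrite /= lfunE // .. |].
by move=> u v uv; rewrite /= !lfunE -!subn1 leq_sub2r.
Qed.

Lemma rmap_chain : chain_mor rmap.
Proof.
split.
- by apply: val_inj; rewrite /= rfunE min0n.
- by apply: val_inj; rewrite /= rfunE /=; apply/minn_idPr.
- by move=> u v uv; rewrite /= !rfunE leq_min !geq_min uv leqnn orbT.
Qed.

Variable G : graph.

Definition nerve_l : cmap (nerve m G) (nerve m.+1 G) :=
  nerve_precomp G lmap_chain.

Definition nerve_r : cmap (nerve m G) (nerve m.+1 G) :=
  nerve_precomp G rmap_chain.

End LeftRight.

(* Main.v *)
Require Import Defs.
From mathcomp Require Import all_boot all_order.
From mathcomp Require Import boolp wochoice zify.

(** Both maps are precomposition with a surjection [h] of intervals that merges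
    two adjacent vertices of the longer interval. Let [s] be a section of [h]
    and [κ := s \o h]: an idempotent monotone map of the longer interval that
    moves one vertex by one edge and fixes the others. Precomposition with [h]
    then identifies N_m G with the cubes [y] of N_(m+1) G that are collapsed,
    that is, invariant under applying [κ] to all coordinates; every other cube
    has to be attached along open boxes. As in a discrete Morse matching, this
    is done by pairing the nondegenerate cubes that are not collapsed.

    Write [collapse a] for [κ] applied to the coordinates of index at least [a],
    and let [level y] be the least [a] such that [y \o collapse a] is pointwise
    equal or adjacent to [y]. The filler of an n-cube [y] is the (n+1)-cube
    [fill y] that, as its last coordinate t grows, switches at a threshold [θ]
    from [y \o collapse (level y)] to [y]; the threshold avoids the edge that
    [κ] contracts, so that [fill y] is invariant under [κ] in the direction t.
    The pairs are ([y], [fill y]). That this is a pairing rests on the choice of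
    the level: being the least one, it is compatible with degeneracies and
    connections ([fill_degen], [fill_conn]), the filler of a filler is
    degenerate ([fill_fill]), and if a nondegenerate cube that is not collapsed
    has a degenerate filler, then it is itself a filler ([fill_critical]). Call a
    coordinate bad if the cube is not invariant under [κ] in it. A cube that is
    not collapsed has a bad coordinate of index at least its level
    ([bad_above_level]); hence every face of [fill y] other than [y] has fewer
    bad coordinates than [y], or no more of them and a smaller level, or is
    itself a filler ([fill_face]). So the open box of [fill y] that
    misses [y] is already present if the pairs are attached in the order of
    dimension and then of rank.

    The general statement about such pairings is [pairing_anodyne]. Each
    attachment is a pushout along an open box because the new cube is glued
    freely: different morphisms of the box category that lie outside the open
    box give different cubes. This is the uniqueness half of the Eilenberg-Zilber
    property, [faceless_determined]. Its core is that a surjective morphism of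
    the box category is determined by its sections. A second morphism with the
    same sections could differ from it only at the absorbing corner of a
    connection, and would then act like max on some pair of coordinates at one
    point and like min on the same pair at another, which no morphism of the box
    category does ([box_conn_type]). *)

Set Implicit Arguments.
Unset Strict Implicit.
Unset Printing Implicit Defensive.

Import Order.TTheory.

(** * Factorization of box morphisms *)

Lemma degen_face (d : Order.disp_t) (T : tbPreorderType d) n (i : 'I_n.+1) e
    (x : cube T n) : degen i (face i e x) = x.
Proof. by apply/funext => j; rewrite /degen /face liftK. Qed.

Section Faces.
Context {d : Order.disp_t} {T : tbPreorderType d}.

Lemma face_diag n (j : 'I_n.+1) e (x : cube T n) :
  face j e x j = if e then \top%O else \bot%O.
Proof. by rewrite /face unlift_none. Qed.

Lemma face_lift n (j : 'I_n.+1) e (x : cube T n) k : face j e x (lift j k) = x k.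
Proof. by rewrite /face liftK. Qed.

End Faces.

Section Connections.
Context {d : Order.disp_t} {T : tbPreorderType d}.
Hypothesis T_anti : antisymmetric (<=%O : rel T).

Definition neutral (e : bool) : T := if e then \top%O else \bot%O.
Definition conn_op (e : bool) (x y : T) : T :=
  if e then Order.min x y else Order.max x y.

(** The order is only a preorder here, whence the explicit antisymmetry
    assumption: it is what makes the top and bottom elements neutral. *)
Lemma conn_op_neutral e x :
  conn_op e x (neutral e) = x /\ conn_op e (neutral e) x = x.
Proof.
have ge (a b : T) : (b <= a)%O -> ((a < b)%O = false) by rewrite lt_leAnge andbC => ->.
have le (a b : T) : (a <= b)%O -> (a < b)%O = false -> a = b.
  by rewrite lt_leAnge => ab; rewrite ab /= => /negbFE ba; apply: T_anti; rewrite ab ba.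
case: e; rewrite /conn_op /neutral ?minElt ?maxElt; split.
- by case: ifP => // h; apply/esym/le; rewrite ?lex1.
- by rewrite ge ?lex1.
- by rewrite ge ?le0x.
- by case: ifP => // h; apply: le; rewrite ?le0x.
Qed.

Lemma conn_face1 n (i : 'I_n.+1) e (x : cube T n.+1) :
  conn i e (face (lift ord0 i) e x) = x.
Proof.
apply/funext => j; rewrite /conn !face_lift face_diag.
by case: eqP => [->|//]; have [] := conn_op_neutral e (x i).
Qed.

Lemma conn_face0 n (i : 'I_n.+1) e (x : cube T n.+1) :
  conn i e (face (lift (lift ord0 i) i) e x) = x.
Proof.
set i1 := lift ord0 i; set i0 := lift i1 i.
apply/funext => j; rewrite /conn -/i1 -/i0.
have v1 : i1 = i.+1 :> nat by [].
have v0 : i0 = i :> nat by rewrite lift_conn leqnn.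
have vl k : lift i0 k = bump i0 k :> nat by [].
case: eqP => [->|ji].
  have -> : i1 = lift i0 i by apply: ord_inj; rewrite v1 vl v0 /bump leqnn.
  by rewrite face_diag face_lift; have [] := conn_op_neutral e (x i).
have -> : lift i1 j = lift i0 j; last exact: face_lift.
apply: ord_inj; rewrite lift_conn vl v0 /bump.
have ne : j <> i :> nat by move=> /ord_inj.
by case: (ltngtP i j) => [||/esym].
Qed.

End Connections.

Definition upd (T : Type) n (x : cube T n) (i : 'I_n) (b : T) : cube T n :=
  fun l => if l == i then b else x l.

Lemma face_degen n (i : 'I_n.+1) e (x : cube bool n.+1) :
  face i e (degen i x) = upd x i e.
Proof.
apply/funext => j; rewrite /face /degen /upd.
case: unliftP => [k ->|->]; last by rewrite eqxx; case: e.
by rewrite eq_sym (negbTE (neq_lift _ _)).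
Qed.

(** The morphisms of the box category without degeneracies: [ι] lists, in
    order, the coordinates of the target that carry those of the source, and all
    other coordinates are constant. *)
Definition face_map p q (f : cube bool p -> cube bool q) : Prop :=
  exists ι : 'I_p -> 'I_q, [/\ forall j k : 'I_p, j < k -> ι j < ι k,
    forall x j, f x (ι j) = x j
    & forall x y k, k \notin codom ι -> f x k = f y k].

Inductive epi_word : forall p q, (cube bool p -> cube bool q) -> Prop :=
| EpiId n : @epi_word n n id
| EpiDegen n (i : 'I_n.+1) : epi_word (@degen _ bool n i)
| EpiConn n (i : 'I_n.+1) e : epi_word (@conn _ bool n i e)
| EpiComp p q r (g : cube bool q -> cube bool r)
    (f : cube bool p -> cube bool q) :
    epi_word g -> epi_word f -> epi_word (g \o f).

Definition epi_mono p q (f : cube bool p -> cube bool q) : Prop :=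
  exists k (m : cube bool k -> cube bool q) (e : cube bool p -> cube bool k),
    [/\ face_map m, epi_word e & f = m \o e].

Lemma face_map_epi_mono p q (f : cube bool p -> cube bool q) : face_map f -> epi_mono f.
Proof. by move=> fP; exists p, f, id; split=> //; constructor. Qed.

Lemma face_map_id n : face_map (@id (cube bool n)).
Proof.
exists id; split=> // x y k /negP[]; apply/codomP; by exists k.
Qed.

Lemma face_map_face n (i : 'I_n.+1) e : face_map (face i e : cube bool n -> _).
Proof.
exists (lift i); split.
- by move=> j k; rewrite ![_ < _]ltnNge /= leq_bump2.
- by move=> x j; rewrite /face liftK.
- move=> x y k; rewrite /face; case: unliftP => [l ->|//] /negP[].
  exact: codom_f.
Qed.

Lemma face_map_comp p q r (g : cube bool q -> cube bool r)
    (f : cube bool p -> cube bool q) : face_map g -> face_map f -> face_map (g \o f).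
Proof.
case=> [a [a1 a2 a3]] [b [b1 b2 b3]]; exists (a \o b); split.
- by move=> j k /b1/a1.
- by move=> x j /=; rewrite a2 b2.
- move=> x y k kP /=; have [/codomP[l kl]|] := boolP (k \in codom a); last exact: a3.
  rewrite kl !a2; apply: b3; apply: contra kP => /codomP[j lj].
  by rewrite kl lj; apply: (codom_f (a \o b)).
Qed.

Lemma ltn_lift n (i : 'I_n) (j k : 'I_n.-1) : (lift i j < lift i k) = (j < k).
Proof. by rewrite !ltnNge /= leq_bump2. Qed.

(** Recognition of face maps into a cube of dimension [q], for a map [g] that is
    read off from a face map [f] by dropping the coordinate [i] of the target;
    [t] selects the coordinates of the source that survive. *)
Lemma face_map_lift p q r (f : cube bool p -> cube bool q.+1) (ι : 'I_p -> 'I_q.+1)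
    (g : cube bool r -> cube bool q) (i : 'I_q.+1) (t : 'I_r -> 'I_p) :
  (forall j k : 'I_p, j < k -> ι j < ι k) -> (forall j k : 'I_r, j < k -> t j < t k) ->
  (forall j, ι (t j) != i) ->
  (forall x k j, ι (t j) = lift i k -> g x k = x j) ->
  (forall x y k, (forall j, ι (t j) <> lift i k) -> g x k = g y k) -> face_map g.
Proof.
move=> iP tP ne g1 g2.
have /fin_all_exists[s sP] : forall j, exists k, ι (t j) = lift i k.
  by move=> j; case: (unliftP i (ι (t j))) (ne j) => [k -> _|->]; [exists k | rewrite eqxx].
exists s; split.
- by move=> j k /tP/iP; rewrite !sP ltn_lift.
- by move=> x j; apply: g1.
- move=> x y k kP; apply: g2 => j; rewrite sP => /lift_inj sk.
  by move/negP: kP; apply; rewrite -sk; apply: codom_f.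
Qed.

(** Either the deleted coordinate is constant on [f] and the composite is again
    a face map, or it carries a coordinate [j0] of the source, on which the
    composite then does not depend. *)
Lemma epi_mono_degen p q (f : cube bool p -> cube bool q.+1) (i : 'I_q.+1) :
  face_map f -> epi_mono (degen i \o f).
Proof.
case=> ι [iP f1 f2].
have iinj j k : ι j = ι k -> j = k.
  move=> jk; apply/val_inj; case: (ltngtP j k) => // /iP; by rewrite jk ltnn.
case: (boolP (i \in codom ι)) => [/codomP[j0 ij0]|iN]; last first.
  apply: face_map_epi_mono; apply: (@face_map_lift p q p f ι _ i id) => //.
  - by move=> j; apply: contra iN => /eqP <-; apply: codom_f.
  - by move=> x k j /= jk; rewrite /degen -jk f1.
  - move=> x y k kP; apply: f2; apply/negP => /codomP[j kj]; exact: (kP j).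
case: p f ι j0 iP f1 f2 iinj ij0 => [|p] f ι j0 iP f1 f2 iinj ij0; first by case: j0 ij0.
exists p, (degen i \o f \o face j0 false), (degen j0); split.
- apply: (@face_map_lift p.+1 q p f ι _ i (lift j0)) => //.
  + by move=> j k; rewrite ltn_lift.
  + move=> j; apply/eqP; rewrite ij0 => /iinj/esym/eqP; by rewrite (negbTE (neq_lift _ _)).
  + by move=> x k j /= jk; rewrite /degen -jk f1 /face liftK.
  + move=> x y k kP /=; rewrite /degen.
    case: (boolP (lift i k \in codom ι)) => [/codomP[j kj]|]; last exact: f2.
    case: (unliftP j0 j) kj => [l -> kj|-> kj]; first by case: (kP l).
    by move: kj; rewrite -ij0 => /esym/eqP; rewrite (negbTE (neq_lift _ _)).
- constructor.
- apply/funext => x; apply/funext => k /=; rewrite face_degen /degen.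
  case: (boolP (lift i k \in codom ι)) => [/codomP[j kj]|]; last exact: f2.
  rewrite kj !f1 /upd; case: eqP => // jj0; move: kj; rewrite jj0 -ij0.
  by move=> /esym/eqP; rewrite (negbTE (neq_lift _ _)).
Qed.

(** Four cases, according to which of the two merged coordinates are constant
    on [f]. If both vary, they carry consecutive coordinates of the source and
    the connection moves to the source. If one is constant, its value is either
    neutral, and the composite is a face map, or absorbing, and the composite
    does not depend on the coordinate carried by the other one. If both are
    constant, the composite is a face map. *)
Lemma epi_mono_conn p q (f : cube bool p -> cube bool q.+2) (i : 'I_q.+1) e :
  face_map f -> epi_mono (conn i e \o f).
Proof.
case=> ι [iP f1 f2].
have iinj j k : ι j = ι k -> j = k.
  move=> jk; apply/ord_inj; case: (ltngtP j k) => // /iP; by rewrite jk ltnn.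
set i1 : 'I_q.+2 := lift ord0 i.
set i0 : 'I_q.+2 := lift i1 i.
have vi1 : i1 = i.+1 :> nat by rewrite /= /bump.
have vi0 : i0 = i :> nat by rewrite lift_conn leqnn.
pose op (a b : bool) := if e then a && b else a || b.
have opE (y : cube bool q.+2) : conn i e y i = op (y i0) (y i1).
  by rewrite /conn eqxx -/i1 -/i0 /op; case: (e); case: (y i0); case: (y i1).
have coE (y : cube bool q.+2) k : k != i -> conn i e y k = y (lift i1 k).
  by rewrite /conn => /negbTE ->.
have nl k : (lift i1 k == i1) = false by rewrite eq_sym (negbTE (neq_lift _ _)).
have l0 k : (lift i1 k == i0) = (k == i) by rewrite (inj_eq lift_inj).
case: (boolP (i1 \in codom ι)) => [/codomP[j1 ij1]|iN1]; last first.
  case: (boolP (i0 \in codom ι)) => [/codomP[j0 ij0]|iN0]; last first.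
    apply: face_map_epi_mono; apply: (@face_map_lift p q.+1 p f ι _ i1 id) => //.
    - by move=> j; apply: contra iN1 => /eqP <-; apply: codom_f.
    - move=> x k j /= jk; rewrite coE -?jk ?f1 //; apply: contra iN0 => /eqP ki.
      by move: jk; rewrite ki -/i0 => <-; apply: codom_f.
    - move=> x y k kP /=; case: (eqVneq k i) => [->|ki].
        by rewrite !opE (f2 x y i0) ?(f2 x y i1).
      rewrite !coE //; apply: f2; apply/negP => /codomP[j kj]; exact: (kP j).
  case: (boolP (f (fun=> false) i1 == e)) => [/eqP fe|fe].
    have {}fe x : f x i1 = e by rewrite (f2 x (fun=> false)).
    apply: face_map_epi_mono; apply: (@face_map_lift p q.+1 p f ι _ i1 id) => //.
    - by move=> j; apply: contra iN1 => /eqP <-; apply: codom_f.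
    - move=> x k j /= jk; case: (eqVneq k i) jk => [->|ki] jk; last by rewrite coE // -jk f1.
      by rewrite opE fe /i0 -jk f1 /op; case: (e); case: (x j).
    - move=> x y k kP /=; case: (eqVneq k i) kP => [->|ki] kP; first by case: (kP j0).
      rewrite !coE //; apply: f2; apply/negP => /codomP[j kj]; exact: (kP j).
  have {}fe x : f x i1 = ~~ e.
    by rewrite (f2 x (fun=> false)) //; move: fe; case: (f _ i1); case: (e).
  case: p f ι j0 iP f1 f2 iinj ij0 iN1 fe => [|p] f ι j0 iP f1 f2 iinj ij0 iN1 fe.
    by case: j0 ij0.
  have cst x y : conn i e (f x) i = conn i e (f y) i.
    by rewrite !opE !fe /op; case: (e); rewrite /= ?andbF ?orbT.
  exists p, (conn i e \o f \o face j0 false), (degen j0); split.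
  + apply: (@face_map_lift p.+1 q.+1 p f ι _ i1 (lift j0)) => //.
    * by move=> j k; rewrite ltn_lift.
    * by move=> j; apply: contra iN1 => /eqP <-; apply: codom_f.
    * move=> x k j /= jk; case: (eqVneq k i) jk => [->|ki] jk; last first.
        by rewrite coE // -jk f1 /face liftK.
      move: jk; rewrite -/i0 ij0 => /iinj/esym/eqP.
      by rewrite (negbTE (neq_lift _ _)).
    * move=> x y k kP /=; case: (eqVneq k i) kP => [-> _|ki kP]; first exact: cst.
      rewrite !coE //.
      case: (boolP (lift i1 k \in codom ι)) => [/codomP[j kj]|]; last exact: f2.
      case: (unliftP j0 j) kj => [l -> kj|-> kj]; first by case: (kP l).
      by move: kj; rewrite -ij0 => /eqP; rewrite l0 (negbTE ki).
  + constructor.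
  + apply/funext => x; apply/funext => k /=; rewrite face_degen.
    case: (eqVneq k i) => [->|ki]; first exact: cst.
    rewrite !coE //.
    case: (boolP (lift i1 k \in codom ι)) => [/codomP[j kj]|]; last exact: f2.
    rewrite kj !f1 /upd; case: eqP => // jj0; move: kj; rewrite jj0 -ij0.
    by move=> /eqP; rewrite l0 (negbTE ki).
case: (boolP (i0 \in codom ι)) => [/codomP[j0 ij0]|iN0].
  have j01 : j1 = j0.+1 :> nat.
    have : j0 < j1.
      rewrite ltnNge; apply/negP => h; suff : i1 <= i0 by rewrite vi1 vi0; lia.
      rewrite ij1 ij0; move: h; rewrite leq_eqVlt => /orP[/eqP/val_inj ->//|/iP].
      exact: ltnW.
    rewrite leq_eqVlt => /orP[/eqP <-//|h].
    have lt : j0.+1 < p by apply: ltn_trans (ltn_ord j1).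
    have := iP j0 (Ordinal lt) (ltnSn _); have := iP (Ordinal lt) j1 h.
    by rewrite -ij1 -ij0 vi0 vi1; lia.
  case: p f ι j0 j1 iP f1 f2 iinj ij0 ij1 j01 => [|[|p]] f ι j0 j1 iP f1 f2 iinj ij0 ij1 j01.
  - by case: j0 ij0 j01.
  - by case: j1 ij1 j01 => -[].
  have j0p : j0 < p.+1 by case: j1 j01 {ij1} => /= b bp E; rewrite -ltnS -E.
  pose j := Ordinal j0p.
  have E1 : j1 = lift ord0 j by apply/ord_inj; rewrite /= /bump j01.
  have E0 : j0 = lift j1 j by apply/ord_inj; rewrite E1 lift_conn leqnn.
  have connE (y : cube bool p.+2) : conn j e y j = op (y j0) (y j1).
    by rewrite /conn eqxx -E1 -E0 /op; case: (e); case: (y j0); case: (y j1).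
  have connN (y : cube bool p.+2) k : k != j -> conn j e y k = y (lift j1 k).
    by rewrite /conn => /negbTE ->; rewrite -E1.
  have opn b : op b e = b by rewrite /op; case: (e); case: b.
  exists p.+1, (conn i e \o f \o face j1 e), (conn j e); split.
  + apply: (@face_map_lift p.+2 q.+1 p.+1 f ι _ i1 (lift j1)) => //.
    * by move=> a b; rewrite ltn_lift.
    * move=> a; rewrite ij1 (inj_eq iinj); by rewrite eq_sym (negbTE (neq_lift _ _)).
    * move=> x k a /= jk; case: (eqVneq k i) jk => [->|ki] jk; last first.
        by rewrite coE // -jk f1 /face liftK.
      rewrite opE ij1 /i0 -jk !f1 /face liftK unlift_none.
      by case: (e) opn => /= opn; apply: opn.
    * move=> x y k kP /=; case: (eqVneq k i) kP => [->|ki] kP.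
        by case: (kP j); rewrite -E0 -ij0.
      rewrite !coE //.
      case: (boolP (lift i1 k \in codom ι)) => [/codomP[a kj]|]; last exact: f2.
      case: (unliftP j1 a) kj => [l -> kj|-> kj]; first by case: (kP l).
      by move: kj; rewrite -ij1 => /eqP; rewrite nl.
  + constructor.
  + have fj1 y : face j1 e y j1 = e :> bool by rewrite /face unlift_none; case: (e).
    have fjl y a : face j1 e y (lift j1 a) = y a :> bool by rewrite /face liftK.
    apply/funext => x; apply/funext => k /=.
    case: (eqVneq k i) => [->|ki].
      by rewrite !opE ij0 ij1 !f1 fj1 E0 fjl connE -E0 opn.
    rewrite !coE //.
    case: (boolP (lift i1 k \in codom ι)) => [/codomP[a kj]|]; last exact: f2.
    rewrite kj !f1; case: (unliftP j1 a) kj => [l -> kj|-> kj]; last first.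
      by move: kj; rewrite -ij1 => /eqP; rewrite nl.
    rewrite fjl connN //; apply: contra ki => /eqP lj; rewrite -l0 kj lj -E0 -ij0 //.
case: (boolP (f (fun=> false) i0 == e)) => [/eqP fe|fe].
  have {}fe x : f x i0 = e by rewrite (f2 x (fun=> false)).
  have eop b : op e b = b by rewrite /op; case: (e); case: b.
  apply: face_map_epi_mono.
  have /fin_all_exists[s sP] : forall j, exists k : 'I_q.+1,
      k = (if ι j <= i then ι j : nat else (ι j).-1) :> nat.
    move=> j; have ub := ltn_ord (ι j); have ui := ltn_ord i.
    have h : (if ι j <= i then ι j : nat else (ι j).-1) < q.+1 by case: ifP => ?; lia.
    by exists (Ordinal h).
  have N0 j : ι j <> i :> nat.
    move=> h; case/negP: iN0; suff -> : i0 = ι j by apply: codom_f.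
    by apply/ord_inj; rewrite vi0 h.
  have sl j k : k != i -> ι j = lift i1 k -> s j = k.
    move=> ki /(congr1 (@nat_of_ord _)); rewrite lift_conn => jk; apply/ord_inj; rewrite sP.
    have ne : k <> i :> nat by move=> /ord_inj E; rewrite E eqxx in ki.
    by case: (leqP k i) jk => h jk; case: (leqP (ι j) i) => h'; lia.
  have ls j : s j != i -> ι j = lift i1 (s j).
    move=> ki; apply/ord_inj; rewrite lift_conn.
    have ne : s j <> i :> nat by move=> /ord_inj E; rewrite E eqxx in ki.
    by move: ne; rewrite sP; have := N0 j; case: (leqP (ι j) i) => h ?; case: leqP; lia.
  have l1 j : s j = i -> ι j = i1.
    move/(congr1 (@nat_of_ord _)); rewrite sP => h; apply/ord_inj; rewrite vi1.
    by have := N0 j; case: (leqP (ι j) i) h; lia.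
  exists s; split.
  + move=> j k /iP jk; rewrite !sP; have := N0 j; have := N0 k.
    by case: (leqP (ι j) i); case: (leqP (ι k) i); lia.
  + move=> x j /=; case: (eqVneq (s j) i) => [E|h]; last by rewrite coE // -ls // f1.
    by rewrite E opE fe eop -(l1 j) // f1.
  + move=> x y k kP /=; case: (eqVneq k i) => [E|ki].
      case/negP: kP; rewrite E; apply/codomP; exists j1; apply/ord_inj.
      by rewrite /= sP -ij1 vi1 ltnn.
    rewrite !coE //; apply: f2; apply: contra kP => /codomP[j kj].
    by apply/codomP; exists j; rewrite (sl j k).
have {}fe x : f x i0 = ~~ e.
  by rewrite (f2 x (fun=> false)) //; move: fe; case: (f _ i0); case: (e).
case: p f ι j1 iP f1 f2 iinj ij1 iN0 fe => [|p] f ι j1 iP f1 f2 iinj ij1 iN0 fe.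
  by case: j1 ij1.
have cst x y : conn i e (f x) i = conn i e (f y) i.
  by rewrite !opE !fe /op; case: (e); rewrite /= ?andbF ?orbT.
exists p, (conn i e \o f \o face j1 false), (degen j1); split.
+ apply: (@face_map_lift p.+1 q.+1 p f ι _ i1 (lift j1)) => //.
  * by move=> j k; rewrite ltn_lift.
  * move=> a; rewrite ij1 (inj_eq iinj); by rewrite eq_sym (negbTE (neq_lift _ _)).
  * move=> x k j /= jk; case: (eqVneq k i) jk => [->|ki] jk; last first.
      by rewrite coE // -jk f1 /face liftK.
    by case/negP: iN0; rewrite /i0 -jk; apply: codom_f.
  * move=> x y k kP /=; case: (eqVneq k i) kP => [-> _|ki kP]; first exact: cst.
    rewrite !coE //.
    case: (boolP (lift i1 k \in codom ι)) => [/codomP[j kj]|]; last exact: f2.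
    case: (unliftP j1 j) kj => [l -> kj|-> kj]; first by case: (kP l).
    by move: kj; rewrite -ij1 => /eqP; rewrite nl.
+ constructor.
+ apply/funext => x; apply/funext => k /=; rewrite face_degen.
  case: (eqVneq k i) => [->|ki]; first exact: cst.
  rewrite !coE //.
  case: (boolP (lift i1 k \in codom ι)) => [/codomP[j kj]|]; last exact: f2.
  rewrite kj !f1 /upd; case: eqP => // jj1; move: kj; rewrite jj1 -ij1.
  by move=> /eqP; rewrite nl.
Qed.

(** Factorizations are stable under composition on the left with a generator,
    so the induction treats [f \o (m \o e)] for a factored map [m \o e]. *)
Lemma box_epi_mono p q (f : cube bool p -> cube bool q) :
  box_mor f -> epi_mono f.
Proof.
suff H : box_mor f -> forall r k (m : cube bool k -> cube bool p)
    (e : cube bool r -> cube bool k), face_map m -> epi_word e -> epi_mono (f \o (m \o e)).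
  by move=> /H/(_ _ _ id id); apply; [exact: face_map_id | constructor].
elim=> {p q f} [n|n i e|n i|n i e|p q r g f _ IHg _ IHf] s k m d mP dP.
- by exists k, m, d.
- by exists k, (face i e \o m), d; split=> //; apply: face_map_comp => //; apply: face_map_face.
- have [l [m' [e' [m'P e'P E]]]] := epi_mono_degen i mP.
  exists l, m', (e' \o d); split=> //; first by constructor.
  by rewrite compA E.
- have [l [m' [e' [m'P e'P E]]]] := epi_mono_conn i e mP.
  exists l, m', (e' \o d); split=> //; first by constructor.
  by rewrite compA E.
- have [l [m' [e' [m'P e'P E]]]] := IHf _ _ _ _ mP dP.
  by rewrite -compA E; apply: IHg.
Qed.

Inductive lowering : forall p q, (cube bool p -> cube bool q) -> Prop :=
| LowDegen p q (g : cube bool p -> cube bool q) (i : 'I_p.+1) :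
    box_mor g -> lowering (g \o @degen _ bool p i)
| LowConn p q (g : cube bool p.+1 -> cube bool q) (i : 'I_p.+1) e :
    box_mor g -> lowering (g \o @conn _ bool p i e).

Lemma lowering_comp p q r (g : cube bool q -> cube bool r)
  (f : cube bool p -> cube bool q) : box_mor g -> lowering f -> lowering (g \o f).
Proof.
move=> gP fP; case: fP g gP => {p q f} p q f i => [fP|e fP] g gP.
- by rewrite compA; apply: LowDegen; apply: BoxComp.
- by rewrite compA; apply: LowConn; apply: BoxComp.
Qed.

Lemma epi_word_box p q (f : cube bool p -> cube bool q) : epi_word f -> box_mor f.
Proof. by elim=> *; econstructor; eauto. Qed.

(** The only words of degeneracies and connections that are not lowering are
    identities. To avoid an equality of dimensions, this is expressed by the
    fact that composition with such a word preserves lowering maps. *)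
Lemma epi_word_lowering p q (f : cube bool p -> cube bool q) : epi_word f ->
  (face_map f /\ forall r (g : cube bool q -> cube bool r),
     lowering g -> lowering (g \o f)) \/ lowering f.
Proof.
elim=> {p q f} [n|n i|n i e|p q r g f gP IHg fP IHf].
- by left; split=> //; apply: face_map_id.
- by right; apply: (@LowDegen _ _ id); constructor.
- by right; apply: (@LowConn _ _ id); constructor.
case: IHf => [[ff low_f]|]; last by right; apply: lowering_comp => //; apply: epi_word_box.
case: IHg => [[fg low_g]|/low_f]; last by right.
left; split; first exact: face_map_comp.
by move=> s h /low_g/low_f.
Qed.

Lemma epi_word_section p q (f : cube bool p -> cube bool q) :
  epi_word f -> exists s : box q p, f \o s = id.
Proof.
elim=> {p q f} [n|n i|n i e|p q r g f gP [s sP] fP [t tP]].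
- by exists (box_id n).
- by exists (box_face i true); apply/funext => x /=; rewrite degen_face.
- by exists (box_face (lift ord0 i) e); apply/funext => x /=; rewrite (conn_face1 le_anti).
- exists (box_comp t s); rewrite -sP; apply/funext => x /=; congr g.
  exact: (congr1 (fun h => h (s x)) tP).
Qed.

Lemma box_face_map_or_lowering p q (f : cube bool p -> cube bool q) :
  box_mor f -> face_map f \/ lowering f.
Proof.
move=> fP; have [k [m [e [mP eP E]]]] := box_epi_mono fP.
have [s sP] := epi_word_section eP.
have mB : box_mor m.
  suff -> : m = f \o s by apply: BoxComp => //; apply: boxP.
  by rewrite E -compA sP.
rewrite E; have [[eM _]|eL] := epi_word_lowering eP.
  by left; apply: face_map_comp.
by right; apply: lowering_comp.
Qed.

(** For [k = q] both bounds together force [ι] to be the identity. *)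
Lemma incr_bounds k q (ι : 'I_k -> 'I_q) :
  (forall i j : 'I_k, i < j -> ι i < ι j) ->
  forall j : 'I_k, j <= ι j /\ ι j + (k - j) <= q.
Proof.
move=> iP j; split.
  case: j => j; elim: j => [|j IH] jk //; apply: leq_ltn_trans (IH (ltnW jk)) _.
  exact: iP.
have [n] := ubnP (k - j); elim: n j => // n IH j; rewrite ltnS => h.
have [e|lt] := eqVneq (k - j) 1; first by rewrite e; have := ltn_ord (ι j); lia.
have jk : j.+1 < k by have := ltn_ord j; lia.
have := IH (Ordinal jk); have := iP j (Ordinal jk) (ltnSn _); rewrite /=; lia.
Qed.

Lemma face_map_leq p q (f : cube bool p -> cube bool q) : face_map f -> p <= q.
Proof.
case=> ι [iP _ _]; case: p f ι iP => // p f ι iP.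
by have [_] := incr_bounds iP ord0; rewrite subn0; lia.
Qed.

Lemma face_map_endo n (f : cube bool n -> cube bool n) : face_map f -> f = id.
Proof.
case=> ι [iP f1 _]; apply/funext => x; apply/funext => j.
suff E : ι j = j by rewrite -{1}E f1.
by apply/ord_inj; have [] := incr_bounds iP j; have := ltn_ord j; lia.
Qed.

(** Equivalently, the image lies in no face; for a box morphism this means
    surjectivity. *)
Definition faceless p q (f : cube bool p -> cube bool q) : Prop :=
  forall j, exists x y, f x j <> f y j.

Lemma faceless_face_map p q (f : cube bool p -> cube bool q) :
  faceless f -> face_map f -> p = q.
Proof.
move=> ff fP; apply/eqP; rewrite eqn_leq (face_map_leq fP) /=.
have [ι [_ _ f2]] := fP.
have sι j : j \in codom ι.
  by apply/negPn/negP => jN; have [x [y]] := ff j; apply; apply: f2.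
rewrite -(card_ord q) -[leqRHS]card_ord; apply: leq_trans (leq_image_card ι predT).
apply/subset_leq_card/subsetP => j _; exact: sι.
Qed.

Lemma faceless_section p q (f : cube bool p -> cube bool q) :
  box_mor f -> faceless f -> exists s : box q p, f \o s = id.
Proof.
move=> fP ff; have [k [m [e [mP eP E]]]] := box_epi_mono fP.
have fm_ : faceless m.
  by move=> j; have [x [y]] := ff j; rewrite E /= => h; exists (e x), (e y).
have kq := faceless_face_map fm_ mP; subst k.
rewrite E (face_map_endo mP) => {E m mP fm_ ff fP f}.
exact: epi_word_section.
Qed.

(** * How box morphisms use their coordinates *)

Lemma upd_updC (T : Type) n (x : cube T n) i k a b : i != k ->
  upd (upd x i a) k b = upd (upd x k b) i a.
Proof.
move=> ik; apply/funext => l; rewrite /upd; case: eqP => // ->.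
by rewrite eq_sym (negbTE ik).
Qed.

Lemma upd_same (T : Type) n (x : cube T n) i : upd x i (x i) = x.
Proof. by apply/funext => l; rewrite /upd; case: eqP => // ->. Qed.

Definition flip n (x : cube bool n) i : cube bool n := upd x i (~~ x i).

(** Each input coordinate influences at most one output coordinate, the same
    one at all points. *)
Definition single_use p q (f : cube bool p -> cube bool q) : Prop :=
  forall i x y j k, f x j <> f (flip x i) j -> f y k <> f (flip y i) k -> j = k.

Lemma flip_neq q (x y : cube bool q) j :
  (forall k, x k <> y k -> k = j) -> x j <> y j -> y = flip x j.
Proof.
move=> xy nj; apply/funext => k; rewrite /flip /upd; case: eqP => [->|kj].
  by case: (x j) (y j) nj => [] [].
by case: (eqVneq (x k) (y k)) => // /eqP /xy.
Qed.

Lemma single_use_flip p q (f : cube bool p -> cube bool q) x i j :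
  single_use f -> f x j <> f (flip x i) j -> f (flip x i) = flip (f x) j.
Proof. by move=> fP h; apply: flip_neq => // k hk; apply: fP hk h. Qed.

Lemma box_single_use p q (f : cube bool p -> cube bool q) :
  box_mor f -> single_use f.
Proof.
elim=> {p q f} [n|n i e|n i|n i e|p q r g f _ IHg _ IHf] a x y j k.
- by rewrite /flip /upd; case: eqP => // ->; case: eqP => // ->.
- rewrite /face; case: unliftP => // j' ->; case: unliftP => // k' ->.
  by rewrite /flip /upd; case: eqP => // ->; case: eqP => // ->.
- rewrite /degen /flip /upd; case: eqP => // <- _; case: eqP => // /lift_inj -> //.
- pose d (l : 'I_n.+1) := forall x : cube bool n.+2,
    a != lift (lift ord0 i) l -> (l == i -> a != lift ord0 i) ->
    conn i e x l = conn i e (flip x a) l.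
  have dP l : d l.
    move=> z h1 h2; have ne b : a != b -> flip z a b = z b.
      by rewrite /flip /upd eq_sym => /negbTE ->.
    rewrite /conn; case: eqP => li; last by rewrite ne.
    by move: h1 h2; rewrite li eqxx => h1 h2; rewrite !ne // h2.
  have two l z : conn i e z l <> conn i e (flip z a) l ->
      a = lift (lift ord0 i) l \/ l = i /\ a = lift ord0 i.
    move=> h; case: (eqVneq a (lift (lift ord0 i) l)) => [|h1]; first by left.
    case: (eqVneq l i) => [li|li]; last by case: h; apply: dP => //; rewrite (negbTE li).
    case: (eqVneq a (lift ord0 i)) => [|h2]; first by right.
    by case: h; apply: dP.
  have nl l : lift (lift ord0 i) l <> lift ord0 i.
    by apply/eqP; rewrite eq_sym neq_lift.
  move=> /two h /two h'; case: h h' => [E|[-> E]] [E'|[-> E']] //.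
  + by apply: (@lift_inj _ (lift ord0 i)); rewrite -E.
  + by case: (nl j); rewrite -E.
  + by case: (nl k); rewrite -E'.
- have H z l : g (f z) l <> g (f (flip z a)) l ->
      exists b, f z b <> f (flip z a) b /\ g (f z) l <> g (flip (f z) b) l.
    move=> h; have [b hb] : exists b, f z b <> f (flip z a) b.
      apply/not_existsP => E; apply: h; congr (g _ l); apply/funext => b.
      by have /contrapT := E b.
    by exists b; split=> //; rewrite -(single_use_flip IHf hb).
  move=> /H[b [hb gb]] /H[c [hc gc]].
  by move: gc; rewrite (IHf a y x c b hc hb); apply: IHg gb.
Qed.

(** At the point [x], the output [j] of a monotone [f] is, as a function of the
    coordinates [i] and [k], the maximum for [e = false] and the minimum for
    [e = true]. *)
Definition conn_like p q (f : cube bool p -> cube bool q) (e : bool) (i k : 'I_p) :=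
  exists x j, [/\ f (upd (upd x i e) k e) j = e,
    f (upd (upd x i (~~ e)) k e) j = ~~ e & f (upd (upd x i e) k (~~ e)) j = ~~ e].

Definition conn_type p q (f : cube bool p -> cube bool q) : Prop :=
  forall i k, i != k -> conn_like f false i k -> conn_like f true i k -> False.

Lemma coord_not_conn_like n (x : cube bool n) a c l (e : bool) : a != c ->
  upd (upd x a e) c e l = e -> upd (upd x a (~~ e)) c e l = ~~ e ->
  upd (upd x a e) c (~~ e) l = ~~ e -> False.
Proof.
move=> ac; rewrite /upd; case: (eqVneq l c) => _; first by case: e.
by case: (eqVneq l a) => _; [case: e | move=> ->; case: e].
Qed.

Definition upd2 n (x : cube bool n) (a c : 'I_n) (b b' : bool) : cube bool n :=
  upd (upd x a b) c b'.

Lemma flip_upd2l n (x : cube bool n) a c b b' : a != c ->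
  flip (upd2 x a c b b') a = upd2 x a c (~~ b) b'.
Proof.
move=> ac; apply/funext => l; rewrite /flip /upd2 /upd (negbTE ac) eqxx.
by case: (eqVneq l a) => // ->; rewrite (negbTE ac).
Qed.

Lemma flip_upd2r n (x : cube bool n) a c b b' :
  flip (upd2 x a c b b') c = upd2 x a c b (~~ b').
Proof.
apply/funext => l; rewrite /flip /upd2 /upd eqxx.
by case: (eqVneq l c).
Qed.

Lemma upd2_id n (x : cube bool n) a c b b' : x a = b -> x c = b' ->
  upd2 x a c b b' = x.
Proof. by move=> <- <-; rewrite /upd2 upd_same upd_same. Qed.

Lemma flip_mono p q (f : cube bool p -> cube bool q) x i j : monotone f ->
  f x j <> f (flip x i) j -> f x j = x i.
Proof.
move=> fP; rewrite /flip; have := @fP (upd x i false) (upd x i true).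
have H l : upd x i false l -> upd x i true l by rewrite /upd; case: eqP.
move=> /(_ H j) h; move: (upd_same x i); case xi: (x i) => /= xE; move: h; rewrite xE.
  by case: (f x j) (f _ j) => [] [] h ne //; by [case: ne | have := h isT].
by case: (f x j) (f (upd x i true) j) => [] [] h ne //; by [case: ne | have := h isT].
Qed.

(** A change of [a] is felt by a single output [s] of [f], and a change of [c]
    by a single output [t]. If [s] and [t] differ, the two coordinates meet in
    [g]; if they agree, they have already met in [f]. *)
Lemma conn_like_comp p q r (g : cube bool q -> cube bool r)
    (f : cube bool p -> cube bool q) e a c :
  monotone f -> single_use f -> a != c -> conn_like (g \o f) e a c ->
  exists s t, [/\ exists z, f z s <> f (flip z a) s,
    exists z, f z t <> f (flip z c) t,
    s != t -> conn_like g e s t & s = t -> conn_like f e a c].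
Proof.
move=> fM fS ac [x [j [/= x1 x2 x3]]].
pose u := upd2 x a c.
have diff y y' : g (f y) j <> g (f y') j -> exists s, f y s <> f y' s.
  move=> h; apply/not_existsP => E; apply: h; congr (g _ j); apply/funext => b.
  by have /contrapT := E b.
have ne b : b <> ~~ b by case: b.
have [s hs] : exists s, f (u e e) s <> f (flip (u e e) a) s.
  by apply: diff; rewrite flip_upd2l // x1 x2.
have [t ht] : exists t, f (u e e) t <> f (flip (u e e) c) t.
  by apply: diff; rewrite flip_upd2r // x1 x3.
have es : f (u e e) s = e.
  by rewrite (flip_mono fM hs) /u /upd2 /upd eqxx; case: eqP.
have et : f (u e e) t = e by rewrite (flip_mono fM ht) /u /upd2 /upd eqxx.
exists s, t; split; [by exists (u e e) | by exists (u e e) | |].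
- move=> st; exists (f (u e e)), j; split=> //.
  + by rewrite -/(upd2 _ _ _ _ _) (upd2_id es et).
  + have -> : upd (upd (f (u e e)) s (~~ e)) t e = f (flip (u e e) a).
      by rewrite (single_use_flip fS hs) -[in RHS](upd2_id es et) flip_upd2l.
    by rewrite flip_upd2l.
  + have -> : upd (upd (f (u e e)) s e) t (~~ e) = f (flip (u e e) c).
      by rewrite (single_use_flip fS ht) -[in RHS](upd2_id es et) flip_upd2r.
    by rewrite flip_upd2r.
- move=> st; subst t; exists x, s; split=> //.
  + by move: hs; rewrite flip_upd2l // es; case: (e); case: (f _ s).
  + by move: ht; rewrite flip_upd2r es; case: (e); case: (f _ s).
Qed.

(** Output coordinates of a box morphism are constants or read-once lattice
    terms, in which two given variables meet at one gate at most. Since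
    [single_use] locates this gate in one factor of a composite, the property is
    inherited by composites. *)
Lemma box_conn_type p q (f : cube bool p -> cube bool q) :
  box_mor f -> conn_type f.
Proof.
elim=> {p q f} [n|n i e|n i|n i e|p q r g f gP IHg fP IHf] a c ac.
- by move=> _ [x [j [h1 h2 h3]]]; apply: (coord_not_conn_like ac h1 h2 h3).
- case=> x [j []]; rewrite /face; case: unliftP => [l _ h1 h2 h3 _|_ -> //].
  exact: (coord_not_conn_like ac h1 h2 h3).
- by move=> _ [x [j [h1 h2 h3]]]; apply: (coord_not_conn_like ac h1 h2 h3).
- have var x l (e' : bool) : upd (upd x a e') c e' l = e' :> bool ->
    upd (upd x a (~~ e')) c e' l = ~~ e' :> bool ->
    upd (upd x a e') c (~~ e') l = ~~ e' :> bool -> False.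
    exact: coord_not_conn_like.
  case=> x [j [x1 x2 x3]] [y [k [y1 y2 y3]]]; move: x1 x2 x3 y1 y2 y3.
  rewrite /conn; case: (eqVneq j i) => [ji|ji]; last first.
    by move=> h1 h2 h3; case: (var x _ false h1 h2 h3).
  case: (eqVneq k i) => [ki|ki]; last first.
    by move=> _ _ _ h1 h2 h3; case: (var y _ true h1 h2 h3).
  set l0 := lift (lift ord0 i) i; set l1 := lift ord0 i.
  case: e => x1 x2 x3 y1 y2 y3.
  + have [l x1l] : exists l, upd (upd x a false) c false l = false :> bool /\
        upd (upd x a true) c false l = true :> bool /\
        upd (upd x a false) c true l = true :> bool.
      move: x1 x2 x3; set u0 := upd _ c false; set u1 := upd _ c false; set u2 := upd _ c true.
      case E0: (u0 l0); [case E1: (u0 l1) => //; exists l1 | exists l0]; move: x2 x3;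
      by case: (u1 l0) => //; case: (u1 l1) => // ; case: (u2 l0) => //; case: (u2 l1).
    by case: x1l => h1 [h2 h3]; apply: (var x l false).
  + have [l y1l] : exists l, upd (upd y a true) c true l = true :> bool /\
        upd (upd y a false) c true l = false :> bool /\
        upd (upd y a true) c false l = false :> bool.
      move: y1 y2 y3; set u0 := upd _ c true; set u1 := upd _ c true; set u2 := upd _ c false.
      case E0: (u0 l0); [exists l0 | case E1: (u0 l1) => //; exists l1]; move: y2 y3;
      by case: (u1 l0) => //; case: (u1 l1) => // ; case: (u2 l0) => //; case: (u2 l1).
    by case: y1l => h1 [h2 h3]; apply: (var y l true).
- have fM := box_mor_monotone fP; have fS := box_single_use fP.
  move=> /(conn_like_comp fM fS ac)[s [t [[x hx] [y hy] gst fst_]]].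
  move=> /(conn_like_comp fM fS ac)[s' [t' [[x' hx'] [y' hy'] gst' fst']]].
  have E := fS _ _ _ _ _ hx hx'; have E' := fS _ _ _ _ _ hy hy'; subst s' t'.
  case: (eqVneq s t) => [st|st]; first by apply: (IHf a c) => //; [apply: fst_ | apply: fst'].
  by apply: (IHg s t) => //; [apply: gst | apply: gst'].
Qed.

(** * Surjective box morphisms are determined by their sections *)

Definition box_degen n (i : 'I_n.+1) : box n.+1 n := Box (BoxDegen i).
Definition box_conn n (i : 'I_n.+1) e : box n.+2 n.+1 := Box (BoxConn i e).

Section Nondegenerate.
Variable Y : cset.

(** A cube that is not the image of a cube of smaller dimension under any
    morphism. Faces raise the dimension, so this amounts to not being in the
    image of a degeneracy or a connection. *)
Definition nondegenerate n (x : Y n) : Prop :=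
  forall k (f : box n k) (z : Y k), k < n -> x <> act f z.

Lemma nondegenerate_face_map n k (x : Y n) (f : box n k) z :
  nondegenerate x -> x = act f z -> face_map f.
Proof.
case: f => f fP xP; have [//|fL] := box_face_map_or_lowering fP.
case: fL fP x xP z => {n k f} [n k f i fP|n k f i e fP] gP x xP z E.
- case: (xP _ (box_degen i) (act (Box fP) z)) => //.
  by rewrite -act_comp E; congr act; apply: box_eq.
- case: (xP _ (box_conn i e) (act (Box fP) z)) => //.
  by rewrite -act_comp E; congr act; apply: box_eq.
Qed.

Definition determined p q (f : box p q) : Prop :=
  forall f' (w : Y q), nondegenerate w -> act f w = act f' w -> f = f'.

(** The two faces in the direction [i] are sections of the degeneracy, and
    together they reach every point. *)
Lemma determined_indep p q (f : box p.+1 q) (i : 'I_p.+1) :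
  (forall g : box p q, faceless g -> determined g) -> faceless f ->
  (forall x b, f (upd x i b) = f x) -> determined f.
Proof.
move=> IH ff fi f' w wP E.
have H b : box_comp f (box_face i b) = box_comp f' (box_face i b).
  apply: (IH _ _ _ w) => //; last by rewrite !act_comp E.
  move=> j; have [x [y]] := ff j; rewrite -(fi x b) -(fi y b) -!face_degen => h.
  by exists (degen i x), (degen i y).
apply: box_eq => x; rewrite -(upd_same x i) -face_degen.
exact: (congr1 (fun g => bfun g (degen i x)) (H (x i))).
Qed.

(** The two sections of a connection reach all points except those where both
    merged coordinates are absorbing. If [f] depends on one of these coordinates,
    then [f'], which agrees with [f] on the sections, behaves like the given
    connection somewhere; a disagreement at an absorbing corner would make [f']
    behave like the opposite connection there. *)
Lemma determined_conn p q (g : box p.+1 q) (i : 'I_p.+1) e :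
  (forall g : box p.+1 q, faceless g -> determined g) ->
  faceless (g \o conn i e) -> determined (box_comp g (box_conn i e)).
Proof.
move=> IH; set f := box_comp g _ => ff f' w wP E.
set i1 : 'I_p.+2 := lift ord0 i; set i0 : 'I_p.+2 := lift i1 i.
have n01 : i0 != i1 by rewrite eq_sym neq_lift.
have gf : faceless g.
  by move=> j; have [x [y h]] := ff j; exists (conn i e x), (conn i e y).
have H1 : g = box_comp f' (box_face i1 e).
  apply: (IH _ gf _ w) => //; rewrite act_comp -E -act_comp; congr act.
  by apply: box_eq => x /=; rewrite (conn_face1 le_anti).
have H0 : g = box_comp f' (box_face i0 e).
  apply: (IH _ gf _ w) => //; rewrite act_comp -E -act_comp; congr act.
  by apply: box_eq => x /=; rewrite (conn_face0 le_anti).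
have agree x : x i0 = e \/ x i1 = e -> f x = f' x.
  case=> h.
    have -> : x = face i0 e (degen i0 x) by rewrite face_degen -h upd_same.
    by rewrite /f /= (conn_face0 le_anti) {1}H0.
  have -> : x = face i1 e (degen i1 x) by rewrite face_degen -h upd_same.
  by rewrite /f /= (conn_face1 le_anti) {1}H1.
pose op (b b' : bool) := if e then b && b' else b || b'.
have fop x b b' c c' : op b b' = op c c' ->
    f (upd2 x i0 i1 b b') = f (upd2 x i0 i1 c c').
  move=> h; rewrite /f /=; apply: (congr1 g); apply/funext => k; rewrite /conn -/i1 -/i0.
  have v0 b1 b2 : upd2 x i0 i1 b1 b2 i0 = b1 :> bool by rewrite /upd2 /upd (negbTE n01) eqxx.
  have v1 b1 b2 : upd2 x i0 i1 b1 b2 i1 = b2 :> bool by rewrite /upd2 /upd eqxx.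
  case: eqP => [_|/eqP ki]; first by move: h; rewrite !v0 !v1 /op; case: (e);
    case: b; case: b'; case: c; case: c'.
  rewrite /upd2 /upd (inj_eq lift_inj) (negbTE ki).
  by rewrite eq_sym (negbTE (neq_lift _ _)).
have [dep|indep] := pselect
    (exists x j, f (upd2 x i0 i1 e e) j <> f (upd2 x i0 i1 (~~ e) e) j); last first.
  apply: (@determined_indep _ _ _ i0) E => // x b.
  have -> : upd x i0 b = upd2 x i0 i1 b (x i1).
    by rewrite /upd2 upd_updC // upd_same.
  rewrite -[in RHS](@upd2_id _ x i0 i1 _ _ erefl erefl).
  have [h|/eqP h] := eqVneq (x i1) e; last first.
    by apply: fop; move: h; rewrite /op; case: (e); case: (x i1); case: b; case: (x i0).
  have eq b' : f (upd2 x i0 i1 b' e) = f (upd2 x i0 i1 e e).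
    have [->//|b'e] := eqVneq b' e; have -> : b' = ~~ e by case: b' (e) b'e => [] [].
    apply/funext => j; apply: contrapT => ne; apply: indep.
    by exists x, j => /esym.
  by rewrite h !eq.
apply: box_eq => x; apply/funext => j; apply: contrapT => ne.
have f'M := box_mor_monotone (boxP f'); have fM := box_mor_monotone (boxP f).
have xE : x = upd2 x i0 i1 (~~ e) (~~ e).
  apply/esym/upd2_id.
    case: (eqVneq (x i0) e) => [h|]; last by case: (e) (x i0) => [] [].
    by case: ne; rewrite agree //; left.
  case: (eqVneq (x i1) e) => [h|]; last by case: (e) (x i1) => [] [].
  by case: ne; rewrite agree //; right.
have u0 z b b' : upd2 z i0 i1 b b' i0 = b :> bool by rewrite /upd2 /upd (negbTE n01) eqxx.
have u1 z b b' : upd2 z i0 i1 b b' i1 = b' :> bool by rewrite /upd2 /upd eqxx.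
have neg b b' : b <> b' -> b = ~~ b' by case: b b' => [] [].
have nee : op (~~ e) (~~ e) = op (~~ e) e by rewrite /op; case: (e).
have een : op (~~ e) e = op e (~~ e) by rewrite /op; case: (e).
(* [f'] behaves like the given connection where [f] depends on i0 ... *)
have L1 : conn_like f' e i0 i1.
  case: dep => z [k]; rewrite -[in X in _ <> X]flip_upd2l // => h.
  have := flip_mono fM h; rewrite u0 => he.
  have hn : f (upd2 z i0 i1 (~~ e) e) k = ~~ e.
    by rewrite -flip_upd2l //; apply: neg => hE; apply: h; rewrite he hE.
  have h1 : f' (upd2 z i0 i1 e e) k = e by rewrite -agree // u0; left.
  have h2 : f' (upd2 z i0 i1 (~~ e) e) k = ~~ e by rewrite -agree ?u1 //; right.
  have h3 : f' (upd2 z i0 i1 e (~~ e)) k = ~~ e.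
    by rewrite -agree ?u0 -?(fop _ _ _ _ _ een) //; left.
  by exists z, k.
(* ... and like the opposite one at the point of disagreement. *)
have L2 : conn_like f' (~~ e) i0 i1.
  have h : f' (upd2 x i0 i1 (~~ e) (~~ e)) j <> f' (flip (upd2 x i0 i1 (~~ e) (~~ e)) i0) j.
    rewrite flip_upd2l // negbK -(agree (upd2 x i0 i1 e (~~ e))); last by left; rewrite u0.
    rewrite -(fop _ _ _ _ _ een) -(fop _ _ _ _ _ nee) -xE => h.
    by apply: ne; rewrite -h.
  have := flip_mono f'M h; rewrite u0 => hn.
  have he : f' (upd2 x i0 i1 e (~~ e)) j = e.
    apply: contrapT => /neg hE; apply: h.
    by rewrite flip_upd2l // negbK hn hE.
  have h3 : f' (upd2 x i0 i1 (~~ e) e) j = e.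
    rewrite -agree; last by right; rewrite u1.
    by rewrite (fop _ _ _ _ _ een) agree ?u0 //; left.
  by exists x, j; rewrite negbK.
by case: (e) L1 L2 => L1 L2; apply: (box_conn_type (boxP f') n01); eassumption.
Qed.

(** Induction on the dimension of the source. A faceless face map is an
    identity, and [f'] is one too because [w] is nondegenerate. *)
Lemma faceless_determined p q (f : box p q) : faceless f -> determined f.
Proof.
have [N] := ubnP p; elim: N p f => // N IH p f; rewrite ltnS => pN ff.
have [fM|fL] := box_face_map_or_lowering (boxP f).
  move=> f' w wP E; have pq := faceless_face_map ff fM; subst p.
  have fI : f = box_id q by apply: box_eq => x; rewrite (face_map_endo fM).
  rewrite fI act_id in E *.
  by apply: box_eq => x; rewrite (face_map_endo (nondegenerate_face_map wP E)).
case: f fL ff => f /= fP fL; case: fL IH fP pN => {p q f} [p q f i fB|p q f i e fB] IH fP pN ff.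
- apply: (@determined_indep _ _ _ i) => // [g|x b]; first exact: IH.
  rewrite /=; congr f; apply/funext => k.
  by rewrite /degen /upd eq_sym (negbTE (neq_lift _ _)).
- have -> : Box fP = box_comp (Box fB) (box_conn i e) by apply: box_eq.
  by apply: determined_conn => // g; apply: IH.
Qed.
End Nondegenerate.

(** * Well-orders, unions of cubical sets, subobjects *)

Section WellOrder.
Variables (T : Type) (R : rel T).
Hypothesis Rwo : well_order R.

Lemma wo_least (P : T -> Prop) : (exists x, P x) ->
  exists x, P x /\ forall y, P y -> R x y.
Proof.
case=> x Px; have [|z [[zP zmin] _]] := Rwo (A := fun y => `[< P y >]).
  by exists x; apply/asboolP.
by exists z; split=> [|y Py]; [apply/asboolP | apply: zmin; apply/asboolP].
Qed.

Lemma wo_total x y : R x y \/ R y x.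
Proof.
have [|z [[->|->] zmin]] := @wo_least (fun z => z = x \/ z = y).
- by exists x; left.
- by left; apply: zmin; right.
- by right; apply: zmin; left.
Qed.

Lemma wo_refl x : R x x. Proof. by case: (wo_total x x). Qed.

Lemma wo_anti x y : R x y -> R y x -> x = y.
Proof.
move=> xy yx; have [|z [_ zu]] := Rwo (A := fun z => `[< z = x \/ z = y >]).
  by exists x; apply/asboolP; left.
have H w : w = x \/ w = y -> minimum_of R (fun z => `[< z = x \/ z = y >]) w.
  move=> wP; split; first exact/asboolP.
  by move=> v /asboolP; case: wP => -> [] ->; rewrite ?wo_refl.
by rewrite -(zu x (H x (or_introl erefl))) -(zu y (H y (or_intror erefl))).
Qed.

Lemma wo_trans x y z : R x y -> R y z -> R x z.
Proof.
move=> xy yz; have [|w [wP wmin]] := @wo_least (fun w => [\/ w = x, w = y | w = z]).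
  by exists x; constructor 1.
have wx : R w x by apply: wmin; constructor 1.
have wy : R w y by apply: wmin; constructor 2.
have wz : R w z by apply: wmin; constructor 3.
case: wP => E; subst w => //; first by rewrite (wo_anti xy wx).
by rewrite -(wo_anti yz wy).
Qed.

Lemma wo_ltP x y : olt R x y \/ R y x.
Proof.
have [->|ne] := pselect (x = y); first by right; apply: wo_refl.
by case: (wo_total x y) => [?|]; [left | right].
Qed.

Lemma wo_le_ltF x y : R x y -> ~ olt R y x.
Proof. by move=> xy [yx]; apply; apply: wo_anti. Qed.

Lemma wo_lt_le_trans x y z : olt R x y -> R y z -> olt R x z.
Proof.
move=> [xy ne] yz; split; first exact: wo_trans yz.
by move=> E; subst z; apply: ne; apply: wo_anti.
Qed.

Lemma wo_ind (P : T -> Prop) :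
  (forall x, (forall y, olt R y x -> P y) -> P x) -> forall x, P x.
Proof.
move=> IH x; apply: contrapT => nx.
have [|z [nz zmin]] := @wo_least (fun z => ~ P z); first by exists x.
apply: nz; apply: IH => y yz; apply: contrapT => /zmin zy; exact: wo_le_ltF zy yz.
Qed.

Definition refine_order (r : T -> nat) : rel T :=
  fun x y => (r x < r y) || (r x == r y) && R x y.

Lemma refine_wo r : well_order (refine_order r).
Proof.
move=> A [x Ax].
have exk : exists k, `[< exists y, y \in A /\ r y = k >].
  by exists (r x); apply/asboolP; exists x.
case: (ex_minnP exk) => k /asboolP[y [Ay yk]] kmin.
have [|z [[Az zk] zmin]] := @wo_least (fun z => z \in A /\ r z = k); first by exists y.
exists z; split.
  split=> // w Aw; rewrite /refine_order zk.
  have : k <= r w by apply: kmin; apply/asboolP; exists w.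
  rewrite leq_eqVlt => /orP[/eqP kw|->//].
  by rewrite -kw ltnn eqxx /=; apply: zmin.
move=> w [Aw wmin]; have := wmin _ Az; rewrite /refine_order zk.
have : k <= r w by apply: kmin; apply/asboolP; exists w.
case: ltngtP => //= wk _ wz.
by apply: wo_anti => //; apply: zmin.
Qed.

End WellOrder.

Lemma refine_lt T (R : rel T) r x y : r x < r y -> olt (refine_order R r) x y.
Proof.
by move=> h; split; [rewrite /refine_order h | move=> E; rewrite E ltnn in h].
Qed.

Lemma refine_lt2 T (R : rel T) r x y : r x = r y -> olt R x y ->
  olt (refine_order R r) x y.
Proof. by move=> h [xy ne]; split=> //; rewrite /refine_order h eqxx xy orbT. Qed.

Lemma well_orderable (T : Type) : exists R : rel T, well_order R.
Proof. by have [R RP] := well_ordering_principle {classic T}; exists R. Qed.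

Section FunctionalRelation.
Variables (A Z : cset) (R : forall n, A n -> Z n -> Prop).
Hypothesis R_ex : forall n (x : A n), exists z, R x z.
Hypothesis R_uniq : forall n (x : A n) z z', R x z -> R x z' -> z = z'.
Hypothesis R_act : forall p q (f : box p q) (x : A q) z,
  R x z -> R (act f x) (act f z).

(** Natural maps are obtained from single-valued total relations that respect
    the action, so that naturality need not be checked on chosen values. *)
Lemma cmap_of_relation : exists w : cmap A Z, forall n (x : A n), R x (w n x).
Proof.
pose w n (x : A n) := sval (cid (R_ex x)).
have wP n (x : A n) : R x (w n x) by apply: (svalP (cid (R_ex x))).
have wn p q (f : box p q) (x : A q) : w p (act f x) = act f (w q x).
  by apply: R_uniq (wP _ _) _; apply: R_act.
by exists (CMap wn).
Qed.
End FunctionalRelation.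

Section Colimit.
Variables (I : Type) (le : rel I) (X : seq_diagram le) (D : I -> Prop).
Variables (L : cset) (c : forall i, D i -> cmap (X i) L).
Hypothesis le_total : forall i j, le i j \/ le j i.
Hypothesis c_cocone : is_cocone c.
Hypothesis c_inj : forall i (Di : D i) n, injective (c Di n).
Hypothesis c_surj : forall n (x : L n), exists i (Di : D i) y, x = c Di n y.

(** A directed union of subobjects is their colimit. *)
Lemma is_colimit_union : is_colimit c.
Proof.
split=> // Z d dP.
pose R n (x : L n) z := exists i (Di : D i) y, x = c Di n y /\ z = d i Di n y.
have cij i j (Di : D i) (Dj : D j) (ij : le i j) n y :
    c Dj n (trans X ij n y) = c Di n y by rewrite -(c_cocone Di Dj ij).
have dij i j (Di : D i) (Dj : D j) (ij : le i j) n y :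
    d j Dj n (trans X ij n y) = d i Di n y by rewrite -(dP i j Di Dj ij).
have [w wR] : exists w : cmap L Z, forall n (x : L n), R n x (w n x).
  apply: cmap_of_relation.
  - by move=> n x; have [i [Di [y xy]]] := c_surj x; exists (d i Di n y), i, Di, y.
  - move=> n x z z' [i [Di [y [xy ->]]]] [j [Dj [y' [xy' ->]]]].
    case: (le_total i j) => ij.
      rewrite -(dij _ _ _ Dj ij); congr (d j Dj n).
      by apply: (c_inj (Di := Dj)); rewrite cij -xy.
    by rewrite -(dij _ _ _ Di ij); congr (d i Di n); apply: (c_inj (Di := Di)); rewrite cij -xy.
  - move=> p q f x z [i [Di [y [-> ->]]]]; exists i, Di, (act f y).
    by rewrite !cmap_nat.
have wc i (Di : D i) n y : w n (c Di n y) = d i Di n y.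
  have [j [Dj [y' [E ->]]]] := wR _ (c Di n y).
  case: (le_total i j) => ij.
    by rewrite -(dij _ _ _ Dj ij); congr (d j Dj n); apply: (c_inj (Di := Dj)); rewrite cij -E.
  by rewrite -(dij _ _ _ Di ij); congr (d i Di n); apply: (c_inj (Di := Di)); rewrite cij -E.
exists w; split; first by move=> i Di; apply: cmap_eq => n y; apply: wc.
move=> w' w'P; apply: cmap_eq => n x; have [i [Di [y ->]]] := c_surj x.
by rewrite wc -(w'P i Di).
Qed.
End Colimit.

Section SubCset.
Variable Y : cset.

Definition act_closed (P : forall n, Y n -> Prop) : Prop :=
  forall p q (f : box p q) (x : Y q), P q x -> P p (act f x).

Section Sub.
Variables (P : forall n, Y n -> Prop) (PS : act_closed P).

Definition sub_act p q (f : box p q) (x : {x : Y q | P x}) : {x : Y p | P x} :=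
  exist _ (act f (sval x)) (PS f (svalP x)).

Lemma sub_act_id n (x : {x : Y n | P x}) : sub_act (box_id n) x = x.
Proof. by case: x => x xP; apply: eq_exist; exact: act_id. Qed.

Lemma sub_act_comp p q r (g : box q r) (f : box p q) (x : {x : Y r | P x}) :
  sub_act (box_comp g f) x = sub_act f (sub_act g x).
Proof. by case: x => x xP; apply: eq_exist; exact: act_comp. Qed.

Definition sub_cset : cset := CSet sub_act_id sub_act_comp.

Definition sub_incl : cmap sub_cset Y :=
  @CMap sub_cset Y (fun n x => sval x) (fun p q f x => erefl).
End Sub.

Lemma sub_cset_map_nat (P Q : forall n, Y n -> Prop) (PS : act_closed P) (QS : act_closed Q)
    (PQ : forall n x, P n x -> Q n x) p q (f : box p q) (x : sub_cset PS q) :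
  exist (Q p) (sval (act f x)) (PQ _ _ (svalP (act f x))) =
  act f (exist (Q q) (sval x) (PQ _ _ (svalP x)) : sub_cset QS q).
Proof. exact: eq_exist. Qed.

Definition sub_cset_map (P Q : forall n, Y n -> Prop) (PS : act_closed P) (QS : act_closed Q)
    (PQ : forall n x, P n x -> Q n x) : cmap (sub_cset PS) (sub_cset QS) :=
  @CMap (sub_cset PS) (sub_cset QS)
    (fun n x => exist (Q n) (sval x) (PQ _ _ (svalP x))) (@sub_cset_map_nat P Q PS QS PQ).
End SubCset.

(** * Attaching paired cubes along open boxes *)

Lemma const_coord_face p q (f : box p q.+1) j :
  (forall x y, f x j = f y j) ->
  f = box_comp (box_face j (f (fun=> false) j)) (box_comp (box_degen j) f).
Proof.
move=> fj; apply: box_eq => x; apply/funext => l /=; rewrite /face.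
case: unliftP => [k ->|->]; first by [].
by rewrite (fj x (fun=> false)); case: (f _ j).
Qed.

Lemma not_faceless p q (f : box p q) : ~ faceless f ->
  exists j, forall x y, f x j = f y j.
Proof.
move=> h; apply: contrapT => /forallNP H; apply: h => j.
apply: contrapT => /forallNP h; case: (H j) => x y.
by apply: contrapT => xy; apply: (h x); exists y.
Qed.

Lemma not_in_open_box n k i e (f : box k n.+1) : ~ in_open_box i e f ->
  faceless f \/ exists g : box k n, faceless g /\ f = box_comp (box_face i e) g.
Proof.
move=> fN; have [|/not_faceless[j fj]] := pselect (faceless f); first by left.
right; have open l : (forall x y, f x l = f y l) -> (l, f (fun=> false) l) = (i, e).
  move=> fl; apply: contrapT => ne; apply: fN.
  exists l, (f (fun=> false) l); split=> //.
  by exists (box_comp (box_degen l) f); apply: const_coord_face.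
have [ji je] := open j fj; have fE := const_coord_face fj.
exists (box_comp (box_degen j) f); split; last by rewrite -je -ji.
apply: contrapT => /not_faceless[l fl].
have [/eqP] := open (lift j l) fl.
by rewrite -ji eq_sym (negbTE (neq_lift _ _)).
Qed.

Section Pairing.
Variables (Y : cset) (X : forall n, Y n -> Prop) (C : forall n, Y n -> Y n.+1).
Variable rk : forall n, Y n -> nat.

Inductive filler : forall n, Y n -> Prop := Filler n (z : Y n) : filler (C z).

(** The cubes that are attached together with their fillers. The filler [C y]
    of a critical cube [y] is never critical itself. *)
Definition critical n (y : Y n) : Prop :=
  [/\ ~ X y, nondegenerate y & ~ filler y].

Definition back n : box n n.+1 := box_face ord_max true.

Hypothesis X_stable : act_closed X.
Hypothesis C_back : forall n (y : Y n), act (back n) (C y) = y.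
Hypothesis C_X : forall n (y : Y n), X y -> ~ nondegenerate (C y).
Hypothesis C_degenerate : forall n (y : Y n),
  ~ nondegenerate y -> ~ nondegenerate (C y).
Hypothesis C_C : forall n (y : Y n), ~ nondegenerate (C (C y)).
Hypothesis C_critical : forall n (y : Y n), critical y -> nondegenerate (C y).
Hypothesis C_face : forall n (y : Y n) j h, critical y ->
  (j, h) <> (ord_max, true) -> let x := act (box_face j h) (C y) in
  [\/ X x, ~ nondegenerate x, filler x | rk x < rk y].

Let cell_index := {s : {n & Y n} | critical (projT2 s)}.
Implicit Types s t : cell_index.
Let dim (t : cell_index) : nat := projT1 (sval t).
Let free t : Y (dim t) := projT2 (sval t).
Let cell t : Y (dim t).+1 := C (free t).

Lemma free_critical t : critical (free t). Proof. exact: svalP t. Qed.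

Definition index_of n (y : Y n) (yP : critical y) : cell_index :=
  exist _ (existT _ n y) yP.

(** The critical case is kept apart because the filler of [x] has larger
    dimension than [x]; all other cubes come from pairs of smaller dimension. *)
Lemma covering n (x : Y n) :
  [\/ X x, critical x
    | exists t, dim t < n /\ exists f, x = act f (cell t)].
Proof.
have [N] := ubnP n; elim: N n x => // N IH n x; rewrite ltnS => nN.
have [xX|xX] := pselect (X x); first by constructor 1.
have [xnd|] := pselect (nondegenerate x); last first.
  move=> /existsNP[k /existsNP[f /existsNP[z /not_implyP[kn /contrapT xE]]]].
  rewrite xE in xX *.
  case: (IH k z (leq_trans kn nN)) => [zX|zc|[t [tk [g zE]]]].
  - by case: xX; apply: X_stable.
  - constructor 3; exists (index_of zc); split=> //.
    by exists (box_comp (back k) f); rewrite act_comp C_back.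
  - constructor 3; exists t; split; first exact: ltn_trans kn.
    by exists (box_comp g f); rewrite zE act_comp.
have [xf|xf] := pselect (filler x); last by constructor 2.
case: xf xX xnd nN => {n x} n z xX xnd nN.
have zc : critical z.
  split.
  - by move=> zX; apply: (C_X zX).
  - by apply: contrapT => zd; apply: (C_degenerate zd).
  - by move=> zf; case: zf xnd => m w; apply: C_C.
constructor 3; exists (index_of zc); split=> //.
by exists (box_id n.+1); rewrite act_id.
Qed.

(** [None] is added as a largest element, at which all pairs are attached. *)
Lemma cell_order : exists le : rel (option cell_index), [/\ well_order le,
  forall i, le i None,
  forall s t, dim s < dim t -> olt le (Some s) (Some t)
  & forall s t, dim s = dim t -> rk (free s) < rk (free t) ->
      olt le (Some s) (Some t)].
Proof.
have [R RP] := well_orderable (option cell_index).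
pose r1 i := if i is Some t then rk (free t) else 0.
pose r2 i := if i is Some t then dim t else 0.
pose r3 (i : option cell_index) := if i is Some _ then 0 else 1.
have R1 := refine_wo RP r1; have R2 := refine_wo R1 r2.
have R3 := refine_wo R2 r3.
exists (refine_order (refine_order (refine_order R r1) r2) r3); split=> //.
- case=> [t|]; last exact: wo_refl.
  by have [] : olt (refine_order (refine_order (refine_order R r1) r2) r3) (Some t) None
    by apply: refine_lt.
- by move=> s t st; apply: refine_lt2 => //; apply: refine_lt.
- move=> s t st rst; apply: refine_lt2 => //; apply: refine_lt2 => //.
  exact: refine_lt.
Qed.

Section Stages.
Variable le : rel (option cell_index).
Hypothesis le_wo : well_order le.
Hypothesis le_None : forall i, le i None.
Hypothesis le_dim : forall s t, dim s < dim t -> olt le (Some s) (Some t).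
Hypothesis le_rk : forall s t, dim s = dim t -> rk (free s) < rk (free t) ->
  olt le (Some s) (Some t).

Definition stage_pred (i : option cell_index) n (x : Y n) : Prop :=
  X x \/ exists t, olt le (Some t) i /\ exists f, x = act f (cell t).

Lemma stage_stable i : act_closed (stage_pred i).
Proof.
move=> p q f x [xX|[t [ti [g ->]]]]; first by left; apply: X_stable.
by right; exists t; split=> //; exists (box_comp g f); rewrite act_comp.
Qed.

Lemma stage_mono i j : le i j -> forall n (x : Y n), stage_pred i x -> stage_pred j x.
Proof.
move=> ij n x [xX|[t [ti xt]]]; first by left.
by right; exists t; split=> //; apply: wo_lt_le_trans ti ij.
Qed.

(** A critical cube is a face of its own filler. *)
Lemma stage_top n (x : Y n) : stage_pred None x.
Proof.
have top t : olt le (Some t) None by split.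
case: (covering x) => [xX|xc|[t [_ xt]]]; [by left | | by right; exists t].
right; exists (index_of xc); split=> //; exists (back n).
by rewrite /cell C_back.
Qed.

Lemma stage_face t j h : (j, h) <> (ord_max, true) ->
  stage_pred (Some t) (act (box_face j h) (cell t)).
Proof.
move=> jh; have [||[s [st xs]]] := covering (act (box_face j h) (cell t)).
- by left.
- move=> xc; have [xX xnd xf] := xc.
  case: (C_face (free_critical t) jh) => // rlt.
  right; exists (index_of xc); split; first exact: le_rk.
  by exists (back (dim t)); rewrite /cell C_back.
- by right; exists s; split=> //; apply: le_dim.
Qed.

Lemma stage_open_box t k (f : box k (dim t).+1) :
  in_open_box ord_max true f -> stage_pred (Some t) (act f (cell t)).
Proof.
case=> j [h [jh [g ->]]]; rewrite act_comp; apply: stage_stable.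
exact: stage_face.
Qed.

(** Cubes of different dimensions are compared in the total space. *)
Definition in_total n (x : Y n) : {n & Y n} := existT _ n x.

Definition total_back (s : {n & Y n}) : {n & Y n} :=
  let: existT n x := s in
  match n return Y n -> {n & Y n} with
  | 0 => fun x => in_total x
  | m.+1 => fun x => in_total (act (back m) x)
  end x.

Lemma total_backC n (y : Y n) : total_back (in_total (C y)) = in_total y.
Proof. by rewrite /= C_back. Qed.

Lemma index_eq s t : in_total (free s) = in_total (free t) -> s = t.
Proof.
case: s t => [[n y] yP] [[m z] zP]; rewrite /free /in_total /= => E.
exact: eq_exist.
Qed.

Lemma cell_nondegenerate t : nondegenerate (cell t).
Proof. exact/C_critical/free_critical. Qed.

Lemma cell_notX t : ~ X (cell t).
Proof.
move=> /(X_stable (back _)); rewrite C_back.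
by have [] := free_critical t.
Qed.

(** Nondegeneracy of [w] makes [f] a face map; outside the open box, only
    the identity and the missing face remain. *)
Lemma nondegenerate_not_open t k (w : Y k) (f : box k (dim t).+1) :
  nondegenerate w -> w = act f (cell t) -> ~ in_open_box ord_max true f ->
  in_total w = in_total (cell t) \/ in_total w = in_total (free t).
Proof.
move=> wP wE /not_in_open_box[ff|[g [gf fE]]].
  have fM := nondegenerate_face_map wP wE.
  left; have E := faceless_face_map ff fM; subst k.
  by rewrite wE (_ : f = box_id _) ?act_id //; apply: box_eq => x; rewrite (face_map_endo fM).
have {fE}wE : w = act g (free t) by rewrite wE fE act_comp C_back.
have gM := nondegenerate_face_map wP wE.
right; have E := faceless_face_map gf gM; subst k.
rewrite wE (_ : g = box_id _) ?act_id //.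
by apply: box_eq => x; rewrite (face_map_endo gM).
Qed.

Lemma filler_total n (y : Y n) s : in_total y = in_total (cell s) -> filler y.
Proof.
move=> E; have : filler (projT2 (in_total (cell s))) by constructor.
by rewrite -E.
Qed.

(** By induction on [s]: a cube of the pair of [t] that occurs in an earlier
    filler is a face of it. It cannot lie in the open box of that filler, which
    belongs to a still earlier stage, so it is one of the two cubes of the
    earlier pair; but a critical cube is not a filler, and each pair is
    determined by either of its members. *)
Lemma fresh s t n (w : Y n) : le (Some s) (Some t) ->
  in_total w = in_total (cell t) \/ in_total w = in_total (free t) ->
  ~ stage_pred (Some s) w.
Proof.
move: s t n w; suff H i : forall s t n (w : Y n), i = Some s -> le i (Some t) ->
  in_total w = in_total (cell t) \/ in_total w = in_total (free t) -> ~ stage_pred i w.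
  by move=> s t n w; apply: H erefl.
elim/(wo_ind le_wo): i => i IH s t n w Ei it wE.
have wnd : nondegenerate w.
  suff : nondegenerate (projT2 (in_total w)) by [].
  by case: wE => ->; [apply: cell_nondegenerate | have [] := free_critical t].
case=> [wX|[r [ri [f wf]]]].
  have : X (projT2 (in_total w)) by [].
  by case: wE => -> ; [apply: cell_notX | have [] := free_critical t].
have rt : olt le (Some r) (Some t) by apply: wo_lt_le_trans ri it.
have [fO|/(nondegenerate_not_open wnd wf)] := pselect (in_open_box ord_max true f).
  apply: (IH _ ri r t n w erefl (proj1 rt) wE).
  by rewrite wf; apply: stage_open_box.
case: wE => -> [] E.
- have := congr1 total_back E; rewrite !total_backC => /index_eq E'.
  by case: rt => _; apply; rewrite E'.
- by have [_ _] := free_critical r; apply; apply: (filler_total (esym E)).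
- by have [_ _] := free_critical t; apply; apply: (filler_total E).
- by case: rt => _; apply; rewrite (index_eq E).
Qed.

(** Outside the open box, [f] is surjective onto the filler or onto the
    missing face, so a section of [f] would bring one of the two new cubes back
    into the stage. *)
Lemma stage_cell_open t k (f : box k (dim t).+1) :
  stage_pred (Some t) (act f (cell t)) -> in_open_box ord_max true f.
Proof.
move=> fS; apply: contrapT => /not_in_open_box[ff|[g [gf fE]]].
  have [s sP] := faceless_section (boxP f) ff.
  apply: (@fresh t t _ (cell t)); [exact: wo_refl | by left |].
  have -> : cell t = act s (act f (cell t)).
    rewrite -act_comp (_ : box_comp f s = box_id _) ?act_id //.
    by apply: box_eq => x; apply: (congr1 (fun h => h x) sP).
  exact: stage_stable.
have [s sP] := faceless_section (boxP g) gf.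
apply: (@fresh t t _ (free t)); [exact: wo_refl | by right |].
have -> : free t = act s (act f (cell t)).
  rewrite fE act_comp C_back -act_comp (_ : box_comp g s = box_id _) ?act_id //.
  by apply: box_eq => x; apply: (congr1 (fun h => h x) sP).
exact: stage_stable.
Qed.

Lemma faceless_cell_free t k (e : box k (dim t).+1) (g : box k (dim t)) :
  faceless e -> act e (cell t) <> act g (free t).
Proof.
move=> ef E; have [s sP] := faceless_section (boxP e) ef.
have : cell t = act (box_comp g s) (free t).
  rewrite act_comp -E -act_comp (_ : box_comp e s = box_id _) ?act_id //.
  by apply: box_eq => x; apply: (congr1 (fun h => h x) sP).
move=> /(nondegenerate_face_map (@cell_nondegenerate t))/face_map_leq; by rewrite ltnn.
Qed.

(** Uniqueness of the Eilenberg-Zilber decomposition, applied to the filler and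
    to its missing face. *)
Lemma cell_inj t k (f f' : box k (dim t).+1) :
  ~ in_open_box ord_max true f -> ~ in_open_box ord_max true f' ->
  act f (cell t) = act f' (cell t) -> f = f'.
Proof.
move=> /not_in_open_box[ff|[g [gf ->]]] /not_in_open_box[ff'|[g' [gf' ->]]].
- exact: (faceless_determined ff (@cell_nondegenerate t)).
- by rewrite act_comp C_back => /(faceless_cell_free ff).
- by rewrite act_comp C_back => /esym/(faceless_cell_free ff').
- rewrite !act_comp !C_back => E; congr box_comp.
  by apply: faceless_determined gf _ _ _ E; have [] := free_critical t.
Qed.

Definition stage_cset (i : option cell_index) : cset := sub_cset (@stage_stable i).

Definition stage_map i j (ij : le i j) : cmap (stage_cset i) (stage_cset j) :=
  sub_cset_map (@stage_stable i) (@stage_stable j) (stage_mono ij).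

Lemma stage_map_id i (ii : le i i) : stage_map ii = cmap_id (stage_cset i).
Proof. by apply: cmap_eq => n [x xP]; apply: eq_exist. Qed.

Lemma stage_map_comp i j k (ij : le i j) (jk : le j k) (ik : le i k) :
  cmap_comp (stage_map jk) (stage_map ij) = stage_map ik.
Proof. by apply: cmap_eq => n [x xP]; apply: eq_exist. Qed.

Definition stages : seq_diagram le := SeqDiagram stage_map_id stage_map_comp.

Lemma stages_continuous : is_continuous stages.
Proof.
move=> j [[i0 i0j] jlim]; apply: is_colimit_union.
- exact: wo_total.
- by move=> i k Di Dk ik; apply: stage_map_comp.
- by move=> i Di n [x xP] [y yP] [xy]; apply: eq_exist.
- move=> n [x [xX|[t [tj xt]]]].
    have xP : stage_pred i0 x by left.
    by exists i0, i0j, (exist _ x xP); apply: eq_exist.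
  have [i [ti ij]] : exists i, olt le (Some t) i /\ olt le i j.
    apply: contrapT => /forallNP H; apply: (jlim (Some t)); split=> //.
  have xP : stage_pred i x by right; exists t.
  by exists i, ij, (exist _ x xP); apply: eq_exist.
Qed.

Lemma stages_colimit :
  @is_colimit _ _ stages (fun=> True) Y (fun i _ => sub_incl (@stage_stable i)).
Proof.
apply: is_colimit_union.
- exact: wo_total.
- by move=> i k Di Dk ik; apply: cmap_eq.
- by move=> i Di n [x xP] [y yP] /= xy; apply: eq_exist.
- by move=> n x; exists None, Logic.I, (exist _ x (stage_top x)).
Qed.

Section Step.
Variables (t : cell_index) (j : option cell_index).
Hypothesis tj : is_succ le (Some t) j.

Lemma succ_stage n (x : Y n) : stage_pred j x ->
  stage_pred (Some t) x \/ exists f, x = act f (cell t).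
Proof.
case=> [xX|[s [sj xs]]]; first by left; left.
have [ts|st] := wo_ltP le_wo (Some t) (Some s); first by case: tj => _ /(_ (Some s)) [].
have [[Est]|ne] := pselect (Some s = Some t); first by subst s; right.
by left; right; exists s.
Qed.

Lemma cell_in_succ k (f : box k (dim t).+1) : stage_pred j (act f (cell t)).
Proof. by right; exists t; split; [case: tj | exists f]. Qed.

Definition attach : cmap (Defs.repr (dim t).+1) (stage_cset j).
Proof.
apply: (@CMap (Defs.repr (dim t).+1) (stage_cset j)
  (fun k f => exist _ (act f (cell t)) (cell_in_succ f))).
by move=> p q f x; apply: eq_exist; rewrite /= act_comp.
Defined.

Definition attach_box : cmap (@open_box (dim t) ord_max true) (stage_cset (Some t)).
Proof.
apply: (@CMap (@open_box (dim t) ord_max true) (stage_cset (Some t))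
  (fun k f => exist _ (act (sval f) (cell t)) (stage_open_box (svalP f)))).
by move=> p q f x; apply: eq_exist; rewrite /= act_comp.
Defined.

(** The square is a union of subobjects: a map out of it is glued from [u] and
    [v]. On a cube outside the earlier stage the value of [u] does not depend on
    the chosen morphism, by [cell_inj]; on the overlap [u] and [v] agree because
    the overlap is exactly the open box, by [stage_cell_open]. *)
Lemma stage_pushout (ij : le (Some t) j) :
  is_pushout (@open_box_incl (dim t) ord_max true) attach_box attach (stage_map ij).
Proof.
split; first by apply: cmap_eq => n x; apply: eq_exist.
move=> Z u v uv.
have uvE k (f : @open_box (dim t) ord_max true k) : u k (sval f) = v k (attach_box k f).
  exact: (congr1 (fun h => capp h f) uv).
pose R n (x : stage_cset j n) z :=
  (exists h : stage_pred (Some t) (sval x), z = v n (exist _ (sval x) h)) \/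
  (exists f, sval x = act f (cell t) /\ z = u n f).
have mixed n (x : stage_cset j n) (h : stage_pred (Some t) (sval x)) f :
    sval x = act f (cell t) -> u n f = v n (exist _ (sval x) h).
  move=> xf; have fO : in_open_box ord_max true f.
    by apply: stage_cell_open; rewrite -xf.
  rewrite (uvE n (exist _ f fO)); congr (v n); exact: eq_exist.
have [w wR] : exists w : cmap (stage_cset j) Z, forall n (x : stage_cset j n), R n x (w n x).
  apply: cmap_of_relation.
  - move=> n [x xj]; have [h|[f xf]] := succ_stage xj.
      by exists (v n (exist _ x h)); left; exists h.
    by exists (u n f); right; exists f.
  - move=> n x z z' [[h ->]|[f [xf ->]]] [[h' ->]|[f' [xf' ->]]].
    + by congr (v n); apply: eq_exist.
    + by rewrite (mixed _ _ h).
    + by rewrite (mixed _ _ h').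
    + have [h|h] := pselect (stage_pred (Some t) (sval x)).
        by rewrite (mixed _ _ h) // (mixed _ _ h).
      congr (u n); apply: (@cell_inj t); rewrite -?xf -?xf' //;
        by move=> /stage_open_box; rewrite -?xf -?xf'.
  - move=> p q f x z [[h ->]|[g [xg ->]]].
      left; exists (stage_stable f h); rewrite -cmap_nat; congr (v p); exact: eq_exist.
    right; exists (box_comp g f); rewrite -cmap_nat; split=> //.
    by rewrite /= xg act_comp.
have wu n f : w n (attach n f) = u n f.
  case: (wR n (attach n f)) => [[h ->]|[g [gf ->]]].
    by rewrite (mixed _ _ h).
  have [h|h] := pselect (stage_pred (Some t) (act f (cell t))).
    by rewrite (mixed _ (attach n f) h) // (mixed _ (attach n f) h).
  congr (u n); apply/esym/(@cell_inj t) => //;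
    by move=> /stage_open_box; rewrite -?gf.
have wv n x : w n (stage_map ij n x) = v n x.
  case: (wR n (stage_map ij n x)) => [[h ->]|[g [gf ->]]].
    by congr (v n); case: x h => x xP h; apply: eq_exist.
  rewrite (mixed _ (stage_map ij n x) (svalP x)) //.
  by congr (v n); case: x {gf} => x xP; apply: eq_exist.
exists w; split; first by split; apply: cmap_eq.
move=> w' [w'u w'v]; apply: cmap_eq => n x.
have [h|[f xf]] := succ_stage (svalP x).
  have -> : x = stage_map ij n (exist _ (sval x) h) by case: x h => x xP h; apply: eq_exist.
  by rewrite wv -w'v.
have -> : x = attach n f by case: x xf => x xP xf; apply: eq_exist.
by rewrite wu -w'u.
Qed.

End Step.

Lemma stages_step (W : cmap_class) i j (ij : le i j) :
  has_open_boxes W -> pushout_closed W -> is_succ le i j ->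
  W _ _ (trans stages ij).
Proof.
move=> Wbox Wpush; case: i ij => [t|] ij tj.
  exact: (Wpush _ _ _ _ _ _ _ _ (stage_pushout tj ij)) (Wbox _ _ _).
case: tj => [Nj _]; by case: (wo_le_ltF le_wo (le_None j) Nj).
Qed.

End Stages.

(** The transfinite composite of the stages starts at the cubes satisfying [X],
    which form a copy of [A]; the copy is exchanged for [A] itself by a retract. *)
Theorem pairing_anodyne (A : cset) (f : cmap A Y) :
  (forall n, injective (f n)) -> (forall n (x : Y n), X x <-> exists a, f n a = x) ->
  anodyne f.
Proof.
move=> finj fX W Wbox Wpush Wret Wtrans.
have [le [lewo leN ledim lerk]] := cell_order.
have [b [_ bmin]] := wo_least lewo (ex_intro (fun=> True) None Logic.I).
have {}bmin i : le b i by apply: bmin.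
have bX n (x : Y n) : stage_pred le b x <-> X x.
  split=> [[//|[t [tb _]]]|]; last by left.
  by case: (wo_le_ltF lewo (bmin (Some t)) tb).
have WL := Wtrans _ le b (stages lewo) Y _ lewo bmin
  (@stages_continuous le lewo)
  (fun i j ij => @stages_step le lewo leN ledim lerk W i j ij Wbox Wpush)
  (stages_colimit lewo leN).
apply: Wret WL.
have [r rP] : exists r : cmap (stage_cset le b) A,
    forall n (x : stage_cset le b n), f n (r n x) = sval x.
  apply: (@cmap_of_relation (stage_cset le b) A
    (fun n (x : stage_cset le b n) a => f n a = sval x)).
  - by move=> n [x xb]; apply/fX/bX.
  - by move=> n x a a' <- /finj.
  - by move=> p q g x a; rewrite cmap_nat => ->.
have iP n (a : A n) : stage_pred le b (f n a) by apply/bX/fX; exists a.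
unshelve eexists.
  apply: (@CMap A (stage_cset le b) (fun n a => exist _ (f n a) (iP n a))).
  by move=> p q g a; apply: eq_exist; rewrite /= cmap_nat.
exists r, (cmap_id Y), (cmap_id Y); split; apply: cmap_eq => n x //=.
by apply: finj; rewrite rP.
Qed.

End Pairing.

(** * Fillers in the nerve of a graph *)

Section Degenerate.
Variable Y : cset.

Inductive degenerate : forall n, Y n -> Prop :=
| DegenerateDegen n (i : 'I_n.+1) (z : Y n) : degenerate (act (box_degen i) z)
| DegenerateConn n (i : 'I_n.+1) e (z : Y n.+1) :
    degenerate (act (box_conn i e) z).

Lemma degenerateP n (x : Y n) : degenerate x <-> ~ nondegenerate x.
Proof.
split; first by case=> {n x} [n i z|n i e z] nd; apply: (nd _ _ z _ erefl).
move=> /existsNP[k /existsNP[f /existsNP[z /not_implyP[kn /contrapT ->]]]].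
have [/face_map_leq|fL] := box_face_map_or_lowering (boxP f); first by rewrite leqNgt kn.
case: f fL => f /= fP fL; case: fL fP z {kn} => {n k f x} [n k f i fB|n k f i e fB] fP z.
- have -> : Box fP = box_comp (Box fB) (box_degen i) by apply: box_eq.
  by rewrite act_comp; constructor.
- have -> : Box fP = box_comp (Box fB) (box_conn i e) by apply: box_eq.
  by rewrite act_comp; constructor.
Qed.

(** Inversion of [degenerate] at a given dimension. *)
Definition degenerate_shape n : Y n -> Prop :=
  match n with
  | 0 => fun=> False
  | p.+1 => fun x => (exists i (z : Y p), x = act (box_degen i) z) \/
      match p return Y p.+1 -> Prop with
      | 0 => fun=> False
      | q.+1 => fun x => exists i e (z : Y q.+1), x = act (box_conn i e) z
      end x
  end.

Lemma degenerate_inv n (x : Y n) : degenerate x -> degenerate_shape x.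
Proof. by case=> {n x} [n i z|n i e z]; [left; exists i, z | right; exists i, e, z]. Qed.

End Degenerate.

Section Collapse.
Variables (m : nat) (G : graph).
Let T := 'I_m.+2.
Variable κ : gmap (interval m.+1) (interval m.+1).
Variable θ : nat.
Hypothesis κ_idem : forall u : T, κ (κ u) = κ u.
Hypothesis κ_mono : forall u v : T, u <= v -> (κ u : T) <= (κ v : T).
Hypothesis κ_sim : forall u : interval m.+1, sim (κ u) u.
Hypothesis θ_gt0 : 0 < θ.
Hypothesis θ_le : θ <= m.+1.
Hypothesis θ_κ : forall t : T, (θ <= (κ t : T)) = (θ <= t).

Local Notation Y := (nerve m.+1 G).

Lemma act_face n (j : 'I_n.+1) h (y : Y n.+1) v :
  (act (box_face j h) y : Y n) v = y (face j h v).
Proof. by rewrite /= ext_face. Qed.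

Lemma act_degen n (j : 'I_n.+1) (y : Y n) v :
  (act (box_degen j) y : Y n.+1) v = y (degen j v).
Proof. by rewrite /= ext_degen. Qed.

Lemma act_conn n (j : 'I_n.+1) e (y : Y n.+1) v :
  (act (box_conn j e) y : Y n.+2) v = y (conn j e v).
Proof. by rewrite /= ext_conn. Qed.

Definition collapse1 n (i : 'I_n) (v : cube T n) : cube T n :=
  fun l => if l == i then κ (v l) else v l.

Definition collapse (a : nat) n (v : cube T n) : cube T n :=
  fun i => if a <= i then κ (v i) else v i.

Lemma collapse_sim a n (v w : gpow (interval m.+1) n) :
  sim v w -> sim (collapse a v : gpow (interval m.+1) n) (collapse a w).
Proof.
case=> [->|[i [vw eq_vw]]]; first by left.
apply: (@sim_gpow _ _ _ _ i) => [|j ji]; last by rewrite /collapse eq_vw.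
by rewrite /collapse; case: ifP => _; [apply: gmap_sim; right | right].
Qed.

Lemma collapse1_sim n i (v : gpow (interval m.+1) n) :
  sim (collapse1 i v : gpow (interval m.+1) n) v.
Proof.
apply: (@sim_gpow _ _ _ _ i) => [|j ji]; rewrite /collapse1.
  by rewrite eqxx; apply: κ_sim.
by rewrite (negbTE ji).
Qed.

Lemma collapse_collapse b a n (v : cube T n) : b <= a ->
  collapse b (collapse a v) = collapse b v.
Proof.
move=> ba; apply/funext => i; rewrite /collapse.
case: (leqP b i) => bi; case: (leqP a i) => ai //.
by have := leq_ltn_trans (leq_trans ba ai) bi; rewrite ltnn.
Qed.

Lemma collapse_collapse_le b a n (v : cube T n) : b <= a ->
  collapse a (collapse b v) = collapse b v.
Proof.
move=> ba; apply/funext => i; rewrite /collapse; case: (leqP a i) => // ai.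
by rewrite (leq_trans ba ai) κ_idem.
Qed.

Lemma collapse_out a n (v : cube T n) : n <= a -> collapse a v = v.
Proof.
move=> na; apply/funext => i; rewrite /collapse; case: (leqP a i) => // ai.
by have := ltn_ord i; lia.
Qed.

Lemma collapseS n (i : 'I_n) (v : cube T n) : collapse i v = collapse1 i (collapse i.+1 v).
Proof.
apply/funext => j; rewrite /collapse /collapse1 -val_eqE /=.
by case: (ltngtP i j) => // ij; rewrite ?ij.
Qed.

Lemma collapse_collapse1 a n (i : 'I_n) (v : cube T n) :
  collapse a (collapse1 i v) = collapse1 i (collapse a v).
Proof. by apply/funext => j; rewrite /collapse /collapse1; case: eqP; case: leqP. Qed.

Lemma collapse_collapse1_le a n (i : 'I_n) (v : cube T n) : a <= i ->
  collapse a (collapse1 i v) = collapse a v.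
Proof.
move=> ai; apply/funext => j; rewrite /collapse /collapse1; case: eqP => [->|//].
by rewrite ai κ_idem.
Qed.

(** Collapsing the coordinates from [a] on moves each value of [y] by at most
    one edge, so that [y] and its collapse are opposite faces of a cube. *)
Definition movable (a : nat) n (y : Y n) : Prop := forall v, sim (y (collapse a v)) (y v).

Lemma movable_dim n (y : Y n) : movable n y.
Proof. by move=> v; rewrite collapse_out //; left. Qed.

Lemma movable_ex n (y : Y n) : exists a, `[< movable a y >].
Proof. by exists n; apply/asboolP/movable_dim. Qed.

(** It exists because nothing is collapsed for [a = n]. *)
Definition level n (y : Y n) : nat := ex_minn (movable_ex y).

Lemma levelP n (y : Y n) : movable (level y) y.
Proof. by rewrite /level; case: ex_minnP => a /asboolP. Qed.

Lemma level_min n (y : Y n) a : movable a y -> level y <= a.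
Proof. by rewrite /level; case: ex_minnP => b _ bmin ya; apply/bmin/asboolP. Qed.

Lemma level_leq n (y : Y n) : level y <= n.
Proof. exact/level_min/movable_dim. Qed.

(** The last coordinate acts as a switch; [fill y] is [y] after this map. *)
Definition slide a n (v : cube T n.+1) : cube T n :=
  if θ <= v ord_max then degen ord_max v else collapse a (degen ord_max v).

Lemma fill_sim n (y : Y n) (v w : gpow (interval m.+1) n.+1) :
  sim v w -> sim (y (slide (level y) v)) (y (slide (level y) w)).
Proof.
case=> [->|[i [vw eq_vw]]]; first by left.
have [Ei|ne] := eqVneq i ord_max.
  have E : degen ord_max v = degen ord_max w.
    by apply/funext => j; apply: eq_vw; rewrite Ei eq_sym neq_lift.
  rewrite /slide E; case: ifP => _; case: ifP => _; try by left.
    by case: (levelP y (degen ord_max w)) => [->|/edge_sym]; [left|right].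
  exact: levelP.
have vwS : sim (degen ord_max v : gpow (interval m.+1) n) (degen ord_max w).
  by apply: sim_degen; right; exists i.
rewrite /slide (eq_vw ord_max) 1?eq_sym //; case: ifP => _; apply: gmap_sim => //.
exact: collapse_sim.
Qed.

Definition fill n (y : Y n) : Y n.+1 := GMap (@fill_sim n y).

Lemma fillE n (y : Y n) v : fill y v = y (slide (level y) v).
Proof. by []. Qed.

Lemma face_last n (j : 'I_n.+1) h (v : cube T n) :
  face j h v j = (if h then ord_max else ord0) :> T.
Proof. by rewrite /face unlift_none; case: h. Qed.

Lemma slide_face_true a n (v : cube T n) : slide a (face ord_max true v) = v.
Proof. by rewrite /slide face_last degen_face /= θ_le. Qed.

Lemma slide_face_false a n (v : cube T n) : slide a (face ord_max false v) = collapse a v.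
Proof. by rewrite /slide face_last degen_face /= leqNgt θ_gt0. Qed.

Lemma fill_back n (y : Y n) : act (back n) (fill y) = y.
Proof. by apply: gmap_eq => v; rewrite act_face fillE slide_face_true. Qed.

Lemma degen_max_collapse b n (v : cube T n.+1) :
  degen ord_max (collapse b v) = collapse b (degen ord_max v).
Proof. by apply/funext => i; rewrite /degen /collapse lift_max. Qed.

Lemma θ_collapse b n (v : cube T n) i : (θ <= collapse b v i) = (θ <= v i).
Proof. by rewrite /collapse; case: ifP. Qed.

Lemma slide_collapse_le b a n (v : cube T n.+1) : b <= a ->
  slide a (collapse b v) = collapse b (degen ord_max v).
Proof.
by move=> ba; rewrite /slide degen_max_collapse collapse_collapse_le //; case: ifP.
Qed.

(** For [b <= a], collapsing from [b] absorbs the collapse from [a]. *)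
Lemma movable_slide b a n (x : Y n.+1) (z : Y n) : (forall v, x v = z (slide a v)) ->
  b <= a -> movable b z -> movable b x.
Proof.
move=> xz ba bz v; rewrite !xz slide_collapse_le // /slide; case: ifP => _; first exact: bz.
by rewrite -(collapse_collapse (degen ord_max v) ba); apply: bz.
Qed.

Lemma slide_movable b a n (x : Y n.+1) (z : Y n) : (forall v, x v = z (slide a v)) ->
  movable b x -> movable b z.
Proof.
move=> xz bx v; have := bx (face ord_max true v); rewrite !xz slide_face_true.
by rewrite /slide θ_collapse face_last /= θ_le degen_max_collapse degen_face.
Qed.

Lemma level_slide a n (x : Y n.+1) (z : Y n) : (forall v, x v = z (slide a v)) ->
  level z <= a -> level x = level z.
Proof.
move=> xz za; apply/eqP; rewrite eqn_leq !level_min //.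
  exact: slide_movable xz (levelP x).
exact: movable_slide xz za (levelP z).
Qed.

Lemma level_fill n (y : Y n) : level (fill y) = level y.
Proof. exact: (level_slide (fillE y)). Qed.

Definition collapsed n (y : Y n) : Prop := forall v, y (fun i => κ (v i)) = y v.

Definition good n (y : Y n) (i : 'I_n) : Prop := forall v, y (collapse1 i v) = y v.

Lemma good_collapse n (y : Y n) b v : (forall i : 'I_n, b <= i -> good y i) ->
  y (collapse b v) = y v.
Proof.
have [k] := ubnP (n - b); elim: k b v => // k IH b v; rewrite ltnS => nb gy.
have [nb'|bn] := leqP n b; first by rewrite collapse_out.
rewrite (collapseS (Ordinal bn)) gy //=; apply: IH; first by lia.
by move=> i bi; apply: gy; apply: ltnW.
Qed.

Lemma collapse0 n (v : cube T n) : collapse 0 v = (fun i => κ (v i)).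
Proof. by []. Qed.

Definition bad n (y : Y n) : {set 'I_n} := [set i | ~~ `[< good y i >]].

Lemma notin_bad n (y : Y n) i : i \notin bad y -> good y i.
Proof. by rewrite inE negbK => /asboolP. Qed.

(** Take the last bad coordinate [i]. Collapsing from [i] on amounts to
    collapsing the coordinate [i] alone, since [y] does not see [κ] in the later
    ones, and this moves the argument by at most one edge. *)
Lemma bad_above_level n (y : Y n) : ~ collapsed y ->
  exists2 i, i \in bad y & level y <= i.
Proof.
move=> yX; have [i0 i0P] : exists i, i \in bad y.
  apply/set0Pn; apply: contra_notN yX => /eqP b0 v.
  by rewrite -collapse0; apply: good_collapse => i _; apply: notin_bad; rewrite b0 inE.
case: (arg_maxnP (fun i : 'I_n => i : nat) i0P) => i iP imax; exists i => //.
apply: level_min => v; have gt (l : 'I_n) : i < l -> good y l.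
  by move=> il; apply: notin_bad; apply/negP => /imax /=; rewrite leqNgt il.
rewrite collapseS -collapse_collapse1 good_collapse //; apply: gmap_sim; exact: collapse1_sim.
Qed.

Lemma collapsed_collapse n (y : Y n) a v : collapsed y -> y (collapse a v) = y v.
Proof. by move=> yX; rewrite -yX -[RHS]yX -!collapse0 collapse_collapse. Qed.

Lemma fill_collapsed n (y : Y n) : collapsed y -> degenerate (fill y).
Proof.
move=> yX; have -> : fill y = act (box_degen ord_max) y; last by constructor.
apply: gmap_eq => v; rewrite act_degen fillE /slide.
by case: ifP => // _; apply: collapsed_collapse.
Qed.

(** * Fillers of degenerate cubes *)

(** Comparison of the levels of [z] and of [y = z \o φ], where [φ] turns the
    collapse from [b] into the collapse from [τ b]. For a connection this fails
    for the index [e] that separates the two merged coordinates, so that [e] must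
    not be a level. *)
Lemma level_transfer n' n (y : Y n') (z : Y n) (φ : cube T n' -> cube T n)
    (s : cube T n -> cube T n') (τ : nat -> nat) (e : nat) :
  (forall v, y v = z (φ v)) -> (forall v, φ (s v) = v) ->
  (forall b v, b <> e -> φ (collapse b v) = collapse (τ b) (φ v)) ->
  (movable e y -> exists2 b, b < e & movable b y) ->
  {homo τ : b c / b <= c} -> (forall c, c <= n -> exists2 b, b <> e & τ b = c) ->
  level z = τ (level y) /\ level y <> e.
Proof.
move=> yz φs φk ey τm τs.
have ne : level y <> e.
  move=> E; have [] := ey; first by rewrite -E; apply: levelP.
  by move=> b be /level_min; rewrite E leqNgt be.
split=> //; apply/eqP; rewrite eqn_leq; apply/andP; split.
  apply: level_min => v; have := levelP y (s v); by rewrite !yz φk // φs.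
have [b be bE] := τs (level z) (level_leq z); rewrite -bE; apply/τm/level_min => v.
by rewrite !yz φk // bE; apply: levelP.
Qed.

Lemma leq_unbump h : {homo unbump h : b c / b <= c}.
Proof. by move=> b c; rewrite /unbump; lia. Qed.

Lemma val_lift n (i : 'I_n) (j : 'I_n.-1) : lift i j = bump i j :> nat.
Proof. by []. Qed.

Lemma lift_liftmax n (i : 'I_n.+1) (j : 'I_n) :
  lift (lift ord_max i) (lift ord_max j) = lift ord_max (lift i j) :> 'I_n.+2.
Proof.
apply: ord_inj; rewrite [RHS]lift_max.
by rewrite val_lift !lift_max.
Qed.

Lemma lift_liftmax_max n (i : 'I_n.+1) :
  lift (lift ord_max i) ord_max = ord_max :> 'I_n.+2.
Proof.
apply: ord_inj; rewrite val_lift lift_max.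
by rewrite /bump -ltnS ltn_ord.
Qed.

Lemma degen_degen_max n (i : 'I_n.+1) (v : cube T n.+2) :
  degen i (degen ord_max v) = degen ord_max (degen (lift ord_max i) v).
Proof. by apply/funext => j; rewrite /degen lift_liftmax. Qed.

Lemma degen_collapse n (i : 'I_n.+1) b (v : cube T n.+1) :
  degen i (collapse b v) = collapse (unbump i b) (degen i v).
Proof. by apply/funext => j; rewrite /degen /collapse /= leq_bump. Qed.

Lemma slide_degen n (i : 'I_n.+1) b (v : cube T n.+2) :
  degen i (slide b v) = slide (unbump i b) (degen (lift ord_max i) v).
Proof.
have E : degen (lift ord_max i) v ord_max = v ord_max.
  by rewrite /degen lift_liftmax_max.
by rewrite /slide E; case: ifP => _; rewrite ?degen_collapse degen_degen_max.
Qed.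

Lemma fill_degen n (i : 'I_n.+1) (z : Y n) :
  fill (act (box_degen i) z) = act (box_degen (lift ord_max i)) (fill z).
Proof.
have [E _] : level z = unbump i (level (act (box_degen i) z)) /\
    level (act (box_degen i) z) <> n.+2.
  apply: (@level_transfer _ _ _ _ (degen i) (face i false) (unbump i)).
  - by move=> v; rewrite act_degen.
  - exact: degen_face.
  - by move=> b v _; apply: degen_collapse.
  - by exists n.+1 => //; apply: movable_dim.
  - exact: leq_unbump.
  - move=> c cn; exists (bump i c); last by rewrite bumpK.
    by rewrite /bump; lia.
apply: gmap_eq => v.
by rewrite [RHS]act_degen !fillE act_degen slide_degen E.
Qed.

Lemma κ_conn_op (e : bool) (x y : T) :
  (κ (if e then Order.min x y else Order.max x y) : T) =
  if e then Order.min (κ x : T) (κ y : T) else Order.max (κ x : T) (κ y : T).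
Proof.
have [xy|/ltW yx] := @leP _ T x y.
  have h : ((κ x : T) <= (κ y : T))%O by exact: κ_mono.
  by case: e; rewrite ?(min_l xy) ?(max_r xy) ?(min_l h) ?(max_r h).
have h : ((κ y : T) <= (κ x : T))%O by exact: κ_mono.
by case: e; rewrite ?(min_r yx) ?(max_l yx) ?(min_r h) ?(max_l h).
Qed.

(** At [b = i + 1] only one of the two merged coordinates would be collapsed. *)
Lemma conn_collapse n (i : 'I_n.+1) e b (v : cube T n.+2) : b <> i.+1 ->
  conn i e (collapse b v) = collapse (unbump i.+1 b) (conn i e v).
Proof.
move=> bi; apply/funext => j; rewrite /conn /collapse; set i1 := lift ord0 i.
have vi1 : i1 = i.+1 :> nat by [].
have vi0 : lift i1 i = i :> nat by rewrite lift_conn leqnn.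
have vj : (b <= lift i1 j) = (unbump i.+1 b <= j) by rewrite val_lift vi1 leq_bump.
case: (eqVneq j i) vj => [->|ji] vj; last by rewrite vj.
have b1 : (b <= i1) = (b <= lift i1 i) by rewrite vi0 vi1; lia.
by rewrite b1 vj; case: leqP => // _; rewrite -κ_conn_op.
Qed.

Lemma conn_max_last n (i : 'I_n.+1) e (v : cube T n.+3) :
  conn (lift ord_max i) e v ord_max = v ord_max.
Proof.
rewrite /conn; have -> : (ord_max == lift ord_max i :> 'I_n.+2) = false.
  by apply/negbTE/neq_lift.
congr v; apply: ord_inj; rewrite lift_conn lift_max /=.
by rewrite leqNgt ltn_ord.
Qed.

Lemma conn_degen_max n (i : 'I_n.+1) e (v : cube T n.+3) :
  conn i e (degen ord_max v) = degen ord_max (conn (lift ord_max i) e v).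
Proof.
apply/funext => j; rewrite /degen /conn (inj_eq lift_inj).
have E1 : lift ord_max (lift ord0 i) = lift ord0 (lift ord_max i) :> 'I_n.+3.
  by apply: ord_inj; rewrite lift_max !(val_lift ord0) lift_max.
have E k : lift ord_max (lift (lift ord0 i) k) =
    lift (lift ord0 (lift ord_max i)) (lift ord_max k) :> 'I_n.+3.
  by apply: ord_inj; rewrite lift_max !lift_conn !lift_max.
by rewrite !E E1.
Qed.

Lemma slide_conn n (i : 'I_n.+1) e b (v : cube T n.+3) : b <> i.+1 ->
  conn i e (slide b v) = slide (unbump i.+1 b) (conn (lift ord_max i) e v).
Proof.
move=> bi; rewrite /slide conn_max_last.
by case: ifP => _; rewrite ?conn_collapse // conn_degen_max.
Qed.

(** Restricting the first of the merged coordinates to its neutral value turns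
    the collapse of the second one alone into the collapse of the merged one. *)
Lemma movable_conn n (i : 'I_n.+1) e (z : Y n.+1) :
  movable i.+1 (act (box_conn i e) z) -> movable i (act (box_conn i e) z).
Proof.
move=> az; have {}az : movable i z.
  move=> v; set i0 : 'I_n.+2 := lift (lift ord0 i) i.
  have E (w : cube T n.+1) : collapse i.+1 (face i0 e w) = face i0 e (collapse i w).
    have v0 : i0 = i :> nat by rewrite lift_conn leqnn.
    apply/funext => j; case: (unliftP i0 j) => [k ->|->]; rewrite /collapse ?face_lift.
      have -> : (i < lift i0 k) = (i <= k).
        rewrite val_lift v0 /bump; case: (leqP i k) => ik //=.
        by rewrite add0n leqNgt ltnS ltnW.
      by [].

    by rewrite v0 ltnn !face_diag.
  have cf (w : cube T n.+1) : conn i e (face i0 e w) = w by apply: conn_face0; apply: le_anti.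
  by have := az (face i0 e v); rewrite !act_conn E !cf.
move=> v; rewrite !act_conn conn_collapse; last by lia.
by rewrite (_ : unbump i.+1 i = i) // /unbump ltnNge leqnSn subn0.
Qed.

Lemma fill_conn n (i : 'I_n.+1) e (z : Y n.+1) :
  fill (act (box_conn i e) z) = act (box_conn (lift ord_max i) e) (fill z).
Proof.
have [E ne] : level z = unbump i.+1 (level (act (box_conn i e) z)) /\
    level (act (box_conn i e) z) <> i.+1.
  apply: (@level_transfer _ _ _ _ (conn i e) (face (lift ord0 i) e) (unbump i.+1)).
  - by move=> v; rewrite act_conn.
  - by move=> v; apply: conn_face1; apply: le_anti.
  - by move=> b v; apply: conn_collapse.
  - by move=> /movable_conn; exists (i : nat).
  - exact: leq_unbump.
  - move=> c cn; exists (bump i.+1 c); last by rewrite bumpK.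
    by rewrite /bump; lia.
apply: gmap_eq => v.
by rewrite [RHS]act_conn !fillE act_conn slide_conn // E.
Qed.

Lemma fill_degenerate n (y : Y n) : degenerate y -> degenerate (fill y).
Proof.
case=> {n y} [n i z|n i e z]; [rewrite fill_degen | rewrite fill_conn]; constructor.
Qed.

(** Both threshold conditions have to be met before the value of [y] appears,
    so the two last coordinates enter through their minimum. *)
Lemma fill_fill n (y : Y n) : degenerate (fill (fill y)).
Proof.
have -> : fill (fill y) = act (box_conn ord_max true) (fill y); last by constructor.
apply: gmap_eq => v; rewrite act_conn 3!fillE level_fill.
congr (y _); set a := level y; set i1 := lift ord0 (@ord_max n).
have E1 : i1 = ord_max by apply: ord_inj; rewrite val_lift.
have E0 : lift i1 ord_max = lift ord_max ord_max by rewrite E1.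
have dd : degen ord_max (conn ord_max true v) = degen ord_max (degen ord_max v).
  apply/funext => j; rewrite /degen /conn -/i1 E1.
  by rewrite eq_sym (negbTE (neq_lift _ _)).
have cl : (θ <= conn ord_max true v ord_max) =
    (θ <= v (lift ord_max ord_max)) && (θ <= v ord_max).
  by rewrite /conn eqxx -/i1 E1 val_min leq_min.
rewrite [RHS]/slide cl dd {2}/slide.
case: (leqP θ (v ord_max)) => _; first by rewrite andbT /slide.
rewrite andbF /slide θ_collapse degen_max_collapse collapse_collapse //.
by case: ifP.
Qed.

Lemma face_comp_max n (i : 'I_n.+1) (v : cube T n.+1) (b : bool) :
  degen (lift ord_max i) (face ord_max b v) = face ord_max b (degen i v).
Proof.
apply/funext => j; rewrite {1}/degen; case: (unliftP ord_max j) => [k ->|->].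
  by rewrite lift_liftmax !face_lift.
by rewrite lift_liftmax_max !face_last.
Qed.

Lemma degen_face_max n (i : 'I_n.+1) h (v : cube T n.+1) :
  degen ord_max (face (lift ord_max i) h v) = face i h (degen ord_max v).
Proof.
apply/funext => j; rewrite {1}/degen; case: (unliftP i j) => [k ->|->].
  by rewrite -lift_liftmax !face_lift.
by rewrite !face_last.
Qed.

Lemma conn_face_max n (i : 'I_n.+1) e (v : cube T n.+2) :
  conn (lift ord_max i) e (face ord_max true v) = face ord_max true (conn i e v).
Proof.
apply/funext => j; case: (unliftP ord_max j) => [k ->|->].
  have := congr1 (fun x : cube T n.+1 => x k)
    (conn_degen_max i e (face ord_max true v)).
  by rewrite degen_face {1}/degen => <-; rewrite face_lift.
by rewrite conn_max_last !face_last.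
Qed.

(** A degeneracy or connection on [fill y] that does not involve the last
    coordinate restricts to [y]. A degeneracy in the last coordinate would make
    [y] equal to its collapse, against [bad_above_level]. A maximum with the last
    coordinate would make [y] independent of its own last coordinate. For a
    minimum, comparing the values on both sides of the threshold shows that [y]
    itself switches at [θ] between its last faces and is a filler. *)
Lemma fill_critical n (y : Y n) : ~ collapsed y -> ~ degenerate y ->
  ~ filler fill y -> ~ degenerate (fill y).
Proof.
move=> yX yd yf fd; have [i ib il] := bad_above_level yX.
have y_top v : y v = fill y (face ord_max true v) by rewrite fillE slide_face_true.
have y_bot v : y (collapse (level y) v) = fill y (face ord_max false v).
  by rewrite fillE slide_face_false.
case: (degenerate_inv fd) => [[j [z zE]]|].
  case: (unliftP ord_max j) zE => [k ->|->] zE.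
    clear j; case: n y yX yd yf fd i ib il y_top y_bot k z zE =>
      [|n] y yX yd yf fd i ib il y_top y_bot k z zE.
      by case: k zE.
    apply: yd.
    have -> : y = act (box_degen k) (act (box_face ord_max true) z); last by constructor.
    by apply: gmap_eq => v; rewrite y_top zE !act_degen face_comp_max act_face.
  move: ib; rewrite inE => /negP; apply; apply/asboolP => v.
  have eq u : y (collapse (level y) u) = y u.
    by rewrite y_bot [RHS]y_top zE !act_degen !degen_face.
  by rewrite -eq collapse_collapse1_le // eq.
case: n y yX yd yf fd i ib il y_top y_bot => [|n] y yX yd yf fd i ib il y_top y_bot //.
case=> j [e [z zE]]; case: (unliftP ord_max j) zE => [k ->|->] zE.
  clear j; case: n y yX yd yf fd i ib il y_top y_bot k z zE =>
    [|n] y yX yd yf fd i ib il y_top y_bot k z zE.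
    by case: k zE.
  apply: yd.
  have -> : y = act (box_conn k e) (act (box_face ord_max true) z); last by constructor.
  by apply: gmap_eq => v; rewrite y_top zE !act_conn conn_face_max act_face.
set i1 : 'I_n.+2 := lift ord0 ord_max.
have E1 : i1 = ord_max by apply: ord_inj; rewrite val_lift.
have neutral_last (v : cube T n.+1) : conn ord_max true (face ord_max true v) = v.
  by rewrite -E1; apply: conn_face1; apply: le_anti.
have max_last (v : cube T n.+1) :
    conn ord_max false (face ord_max true v) = face ord_max true (degen ord_max v).
  apply/funext => l; rewrite /conn -/i1 E1; case: (unliftP ord_max l) => [k ->|->].
    by rewrite eq_sym (negbTE (neq_lift _ _)) !face_lift.
  rewrite eqxx !face_last; apply: ord_inj; rewrite val_max face_lift.
  by apply/maxn_idPr; rewrite leq_ord.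
have min_bot (v : cube T n.+1) :
    conn ord_max true (face ord_max false v) = face ord_max false (degen ord_max v).
  apply/funext => l; rewrite /conn -/i1 E1; case: (unliftP ord_max l) => [k ->|->].
    by rewrite eq_sym (negbTE (neq_lift _ _)) !face_lift.
  rewrite eqxx !face_last; apply: ord_inj; rewrite val_min face_lift.
  by rewrite minn0.
(* e = false is the maximum *)
case: e zE => zE; last first.
  apply: yd.
  have -> : y = act (box_degen ord_max) (act (box_face ord_max true) z); last by constructor.
  by apply: gmap_eq => v; rewrite y_top zE act_conn act_degen max_last act_face.
have yz : y = z by apply: gmap_eq => v; rewrite y_top zE act_conn neutral_last.
rewrite -yz in zE; pose w : Y n := act (back n) y.
have wE u : w u = y (face ord_max true u) by rewrite act_face.
(* Inserting the last vertex before the last coordinate expresses [y]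
   through its own filler. *)
have split_last v : y v = if θ <= v ord_max then w (degen ord_max v)
    else y (face ord_max false (degen ord_max v)).
  pose V := face (lift i1 ord_max) true v.
  have VE : conn ord_max true V = v by apply: conn_face0; apply: le_anti.
  have := congr1 (fun f : Y n.+2 => f V) zE; rewrite act_conn VE fillE => <-.
  have i1m : lift i1 ord_max = lift ord_max ord_max by rewrite E1.
  have Vl : V ord_max = v ord_max.
    by rewrite /V i1m -[W in face _ _ _ W](lift_liftmax_max ord_max) face_lift.
  have Vd : degen ord_max V = face ord_max true (degen ord_max v).
    by rewrite /V i1m degen_face_max.
  rewrite /slide Vl Vd wE; case: ifP => // _.
  by rewrite y_bot zE act_conn min_bot degen_face.
have y_psi v : y v = w (slide (level y) v).
  rewrite split_last /slide; case: ifP => // _.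
  have := y_bot (face ord_max true (degen ord_max v)).
  rewrite zE act_conn min_bot degen_face => <-.
  by rewrite split_last θ_collapse face_last /= θ_le degen_max_collapse degen_face.
have lw : level w = level y.
  apply/eqP; rewrite eqn_leq; have wy : level w <= level y.
    by apply: level_min; apply: slide_movable y_psi (levelP y).
  by rewrite wy; apply: level_min; apply: movable_slide y_psi wy (levelP w).
apply: yf; have -> : y = fill w; last by constructor.
by apply: gmap_eq => v; rewrite fillE lw.
Qed.

(** * Faces of fillers *)

(** The lexicographic order of the number of bad coordinates and the level,
    which is at most [n]. *)
Definition rank n (y : Y n) : nat := #|bad y| * n.+1 + level y.

Lemma rank_bad n (x y : Y n) : #|bad x| < #|bad y| -> rank x < rank y.
Proof.
move=> xy; rewrite /rank; apply: (@leq_trans (#|bad x|.+1 * n.+1)).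
  by rewrite mulSn addnC ltn_add2r ltnS level_leq.
by apply: leq_trans (leq_addr _ _); rewrite leq_mul2r xy orbT.
Qed.

Lemma rank_level n (x y : Y n) : #|bad x| <= #|bad y| -> level x < level y ->
  rank x < rank y.
Proof.
move=> xy l; rewrite /rank -addnS leq_add // leq_mul2r xy orbT //.
Qed.

Lemma good_collapse1 n (y : Y n) a i : good y i ->
  forall v, y (collapse a (collapse1 i v)) = y (collapse a v).
Proof. by move=> yi v; rewrite collapse_collapse1 yi. Qed.

(** The face opposite to [y] is the collapse of [y], which is good in some bad
    coordinate of [y]; a face in a bad direction loses that coordinate. Both have
    fewer bad coordinates. In a good direction [k] the face of [fill y] is the
    face [z] of [y], switched to its collapse from the index
    [unbump k (level y)] on. That index bounds the level of [z]: if it is the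
    level, the face is the filler of [z]; otherwise the level of the face, being
    that of [z], is smaller than that of [y]. *)
Lemma fill_face n (y : Y n) j h : ~ collapsed y -> (j, h) <> (ord_max, true) ->
  let x := act (box_face j h) (fill y) in filler fill x \/ rank x < rank y.
Proof.
move=> yX jh x; have [i ib il] := bad_above_level yX.
case: (unliftP ord_max j) @x jh => [k|] -> x; last first.
  case: h @x => // x _; right; apply: rank_bad; apply: proper_card.
  have xE v : x v = y (collapse (level y) v) by rewrite act_face fillE slide_face_false.
  apply/properP; split.
    apply/subsetP => l; apply: contraLR => /notin_bad lg; rewrite inE negbK.
    by apply/asboolP => v; rewrite !xE good_collapse1.
  exists i => //; rewrite inE negbK; apply/asboolP => v.
  by rewrite !xE collapse_collapse1_le.
move=> _; clear j.
case: n y yX i ib il k @x => [|n] y yX i ib il k x; first by case: k @x.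
set a := level y; pose z : Y n := act (box_face k h) y.
have xE v : x v = if θ <= v ord_max then y (face k h (degen ord_max v))
    else y (collapse a (face k h (degen ord_max v))).
  rewrite act_face fillE /slide degen_face_max.
  rewrite -[W in face (lift _ _) _ _ W](lift_liftmax_max k) face_lift -/a.
  by case: ifP.
have collapse1_face l (v : cube T n) :
    face k h (collapse1 l v) = collapse1 (lift k l) (face k h v).
  apply/funext => b; rewrite /collapse1; case: (unliftP k b) => [c ->|->].
    by rewrite !face_lift (inj_eq lift_inj).
  by rewrite (negbTE (neq_lift _ _)) !face_last.
have x_max : good x ord_max.
  move=> v; rewrite !xE.
  have -> : degen ord_max (collapse1 ord_max v) = degen ord_max v.
    by apply/funext => l; rewrite /degen /collapse1 eq_sym (negbTE (neq_lift _ _)).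
  by rewrite /collapse1 eqxx θ_κ.
have x_good l : good y (lift k l) -> good x (lift ord_max l).
  move=> yl v; rewrite !xE.
  have -> : degen ord_max (collapse1 (lift ord_max l) v) = collapse1 l (degen ord_max v).
    by apply/funext => b; rewrite /degen /collapse1 (inj_eq lift_inj).
  rewrite {1}/collapse1 (negbTE (neq_lift _ _)) collapse1_face good_collapse1 // yl //.
have xb : #|bad x| <= #|bad y :\ k|.
  pose K := [set l : 'I_n | lift k l \in bad y].
  have xK : bad x \subset lift ord_max @: K.
    apply/subsetP => b bb; case: (unliftP ord_max b) bb => [l ->|->].
      move=> bl; apply: imset_f; rewrite inE; apply: contraLR bl => /notin_bad/x_good lg.
      by rewrite inE negbK; apply/asboolP.
    by rewrite inE => /negP[]; apply/asboolP.
  have Ky : lift k @: K \subset bad y :\ k.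
    apply/subsetP => _ /imsetP[l lK ->].
    by rewrite !inE eq_sym neq_lift /=; move: lK; rewrite !inE.
  apply: leq_trans (subset_leq_card xK) _; rewrite card_imset; last exact: lift_inj.
  by rewrite -(card_imset _ (@lift_inj _ k)) subset_leq_card.
have [kb|/notin_bad kg] := boolP (k \in bad y).
  by right; apply: rank_bad; apply: leq_ltn_trans xb _; rewrite [ltnRHS](cardsD1 k) kb.
have {}xb : #|bad x| <= #|bad y| by apply: leq_trans xb (subset_leq_card (subD1set _ _)).
have zE a' v : a' = unbump k a -> y (collapse a (face k h v)) = z (collapse a' v).
  move=> ->; rewrite act_face.
  have E : collapse a (face k h v) =
      (if a <= k then collapse1 k (face k h (collapse (unbump k a) v))
       else face k h (collapse (unbump k a) v)).
    have El l : collapse a (face k h v) (lift k l) =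
        face k h (collapse (unbump k a) v) (lift k l).
      by rewrite face_lift /collapse face_lift val_lift leq_bump.
    apply/funext => b; case: (unliftP k b) => [l ->|->].
      by case: ifP => _; rewrite /collapse1 ?El // eq_sym (negbTE (neq_lift _ _)).
    by rewrite {1}/collapse; case: ifP => _; rewrite /collapse1 ?eqxx !face_last.
  by rewrite E; case: ifP => // _; rewrite kg.
have x_psi v : x v = z (slide (unbump k a) v).
  by rewrite xE /slide; case: ifP => _; [rewrite act_face | apply: zE].
have za : movable (unbump k a) z.
  by move=> v; rewrite -(zE _ _ erefl) act_face; apply: levelP.
have := level_min za; rewrite leq_eqVlt => /orP[/eqP E|lt].
  left; have -> : x = fill z; last by constructor.
  by apply: gmap_eq => v; rewrite x_psi fillE E.
right; apply: rank_level => //; rewrite (level_slide x_psi (ltnW lt)) -/a.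
by apply: leq_trans lt _; rewrite /unbump leq_subr.
Qed.

Section Nerve.
Variables (h : gmap (interval m.+1) (interval m)) (hP : chain_mor h).
Variable s : gmap (interval m) (interval m.+1).
Hypothesis hs : forall u, h (s u) = u.
Hypothesis κE : forall u, κ u = s (h u).

Lemma nerve_precomp_inj n : injective (nerve_precomp G hP n).
Proof.
move=> x y xy; apply: gmap_eq => v.
have := congr1 (fun f : Y n => f (fun i => s (v i))) xy.
by rewrite /= (_ : h \o _ = v) //; apply/funext => i /=.
Qed.

Lemma nerve_precompP n (y : Y n) :
  collapsed y <-> exists x, nerve_precomp G hP n x = y.
Proof.
split=> [yX|[x <-] v]; last first.
  by congr (x _); apply/funext => i /=; rewrite κE hs.
exists (gcomp y (gpow_map s n)); apply: gmap_eq => v /=.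
by rewrite -[RHS]yX; congr (y _); apply/funext => i /=; rewrite κE.
Qed.

(** Since [h \o s] is the identity, the collapsed cubes are those that factor
    through [h]. *)
Lemma nerve_precomp_anodyne : anodyne (nerve_precomp G hP).
Proof.
have X_closed : act_closed collapsed.
  move=> p q f x /nerve_precompP[a <-]; apply/nerve_precompP.
  by exists (act f a); rewrite cmap_nat.
apply: (@pairing_anodyne Y collapsed fill rank) => //.
- exact: fill_back.
- by move=> n y yX; apply/degenerateP; apply: fill_collapsed.
- by move=> n y /degenerateP yd; apply/degenerateP; apply: fill_degenerate.
- by move=> n y; apply/degenerateP; apply: fill_fill.
- move=> n y [yX ynd yf]; apply: contrapT => /degenerateP; apply: fill_critical => //.
  by move/degenerateP.
- move=> n y j e [yX _ _] je x; have [xf|xr] := fill_face yX je.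
    by constructor 3.
  by constructor 4.
- exact: nerve_precomp_inj.
- exact: nerve_precompP.
Qed.

End Nerve.
End Collapse.

(** * The two inclusions of nerves *)

Lemma lmap_section_sim m (u v : interval m) :
  sim u v -> sim (lift ord0 u : interval m.+1) (lift ord0 v).
Proof. by move=> /sim_intervalE uv; apply/sim_intervalE; rewrite /= /bump /= !add1n !ltnS. Qed.

Definition lsection m : gmap (interval m) (interval m.+1) := GMap (@lmap_section_sim m).

Lemma rmap_section_sim m (u v : interval m) :
  sim u v -> sim (lift ord_max u : interval m.+1) (lift ord_max v).
Proof. by move=> /sim_intervalE uv; apply/sim_intervalE; rewrite !lift_max. Qed.

Definition rsection m : gmap (interval m) (interval m.+1) := GMap (@rmap_section_sim m).

Theorem theorem4p12 (m : nat) (hm : 0 < m) (G : graph) :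
  anodyne (nerve_l m G) /\ anodyne (nerve_r m G).
Proof.
have lE u : lmap m (lsection m u) = u.
  by apply: ord_inj; rewrite lfunE.
have rE u : rmap m (rsection m u) = u.
  apply: ord_inj; rewrite rfunE lift_max; apply/minn_idPl; exact: leq_ord.
have lv (u : 'I_m.+2) : (lsection m (lmap m u) : 'I_m.+2) = maxn u 1 :> nat.
  by rewrite val_lift lfunE /bump /=; lia.
have rv (u : 'I_m.+2) : (rsection m (rmap m u) : 'I_m.+2) = minn u m :> nat.
  by rewrite lift_max rfunE.
split.
(* [lmap] merges 0 and 1; the threshold 2 is a vertex because m > 0. *)
- apply: (@nerve_precomp_anodyne m G (gcomp (lsection m) (lmap m)) 2
    _ _ _ _ _ _ _ _ (lsection m)) => //.
  + by move=> u; congr (lsection m _); apply: lE.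
  + by move=> u v uv; rewrite !lv; lia.
  + by move=> u; apply/sim_intervalE; rewrite lv; lia.
  + by move=> u; rewrite lv; lia.
(* [rmap] merges m and m + 1, both at least 1 because m > 0. *)
- apply: (@nerve_precomp_anodyne m G (gcomp (rsection m) (rmap m)) 1
    _ _ _ _ _ _ _ _ (rsection m)) => //.
  + by move=> u; congr (rsection m _); apply: rE.
  + by move=> u v uv; rewrite !rv; lia.
  + by move=> u; apply/sim_intervalE; rewrite rv; have := leq_ord u; lia.
  + by move=> u; rewrite rv; lia.
Qed.
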